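(* Let $J(g)$ and $\widetilde J(\widetilde g)$ be two self-adjoint semi-infinite Jacobi operators with discrete spectrum, with coefficients $(a_n),(b_n)$ and $(\widetilde a_n),(\widetilde b_n)$ respectively, where $g,\widetilde g\in\mathbb{R}\cup\{\infty\}$. Let $h_1\neq h_2$ and $\widetilde h_1\ne\widetilde h_2$ be real numbers. Write $\sigma(J_{h_1}(g))=\{\lambda_n\}_{n\in M}$, $\sigma(J_{h_2}(g))=\{\nu_n\}_{n\in M}$, $\sigma(\widetilde J_{\widetilde h_1}(\widetilde g))=\{\widetilde\lambda_n\}_{n\in M}$, $\sigma(\widetilde J_{\widetilde h_2}(\widetilde g))=\{\widetilde\nu_n\}_{n\in M}$, with the same index set $M\subset\mathbb{Z}$, each pair of spectra being enumerated according to the convention described in the context. Let $\{\gamma_n(h_1)\}_{n\in M}$ and $\{\widetilde\gamma_n(\widetilde h_1)\}_{n\in M}$ be the norming constants corresponding to $J_{h_1}(g)$ and $\widetilde J_{\widetilde h_1}(\widetilde g)$. Let $A\subset M$ and suppose that $$\lambda_n=\widetilde\lambda_n\ (n\in M),\qquad \nu_n=\widetilde\nu_n\ (n\in M\setminus A),\qquad \gamma_n(h_1)=\widetilde\gamma_n(\widetilde h_1)\ (n\in A),$$ that $\nu_m=\widetilde\nu_m$ for some $m\in A$, and that $h_1=\widetilde h_1$ (respectively $h_2=\widetilde h_2$). Then $a_n=\widetilde a_n$ and $b_n=\widetilde b_n$ for all $n\in\mathbb{N}$, $h_2=\widetilde h_2$ (respectively $h_1=\widetilde h_1$), and, if $J_{min}\neq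 J_{min}^*$ (limit circle case), also $g=\widetilde g$. In other words, $\{\lambda_n\}_{n\in M}$, $\{\nu_n\}_{n\in M\setminus A}$, $\{\gamma_n(h_1)\}_{n\in A}$, $h_1$ (respectively $h_2$) and $\nu_m$ for some $m\in A$ uniquely determine the operator $J(g)$, $h_2$ (respectively $h_1$) and, in the limit circle case, the boundary condition $g$ at infinity.
   Context: Jacobi operators. Given $a_n\in\mathbb{R}$, $b_n>0$ ($n\in\mathbb{N}=\{1,2,\dots\}$), let $(\tau f)_1=a_1f_1+b_1f_2$ and $(\tau f)_n=b_{n-1}f_{n-1}+a_nf_n+b_nf_{n+1}$ for $n\ge 2$. In $l^2(\mathbb{N})$ let $J_{min}$ be $\tau$ on the finitely supported sequences and $J_{max}=J_{min}^*$ be $\tau$ on $\{f\in l^2(\mathbb{N}):\tau f\in l^2(\mathbb{N})\}$. The limit point case is when $\overline{J_{min}}$ is self-adjoint; otherwise one is in the limit circle case (written $J_{min}\ne J_{min}^*$). In the limit point case put $J(g):=\overline{J_{min}}$ for every $g\in\mathbb{R}\cup\{\infty\}$. In the limit circle case let $c_0,s_0$ be the sequences satisfying $b_{n-1}u_{n-1}+a_nu_n+b_nu_{n+1}=0$ for $n\ge2$ with $c_0(1)=1,c_0(2)=0$, $s_0(1)=0,s_0(2)=1$; for $g=\cot\alpha$, $\alpha\in[0,\pi)$ (with $g=\infty$ for $\alpha=0$), put $v_\alpha=\cos(\alpha)c_0+\sin(\alpha)s_0$ and let $J(g)$ be the restriction of $J_{max}$ to $\{f\in\mathcal{D}(J_{max}):\lim_{n\to\infty}W_n(v_\alpha,f)=0\}$,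 where $W_n(f,k)=b_n(f(n)k(n+1)-k(n)f(n+1))$. These are all the self-adjoint extensions of $J_{min}$, and distinct $g$ give distinct extensions. For $h\in\mathbb{R}$, $J_h(g):=J(g)-h\langle\cdot,e_1\rangle e_1$, where $e_1$ is the first canonical basis vector; $h$ is called a boundary condition at the origin. ''Discrete spectrum'' means that the spectrum $\sigma(J(g))$ consists of isolated eigenvalues of finite multiplicity (then the same holds for every $J_h(g)$, and all eigenvalues are simple). The same notation with tildes is used for the operator with coefficients $\widetilde a_n,\widetilde b_n$. Norming constants. If $\lambda_k$ is an eigenvalue of $J_h(g)$ and $u$ is its eigenvector normalized by $u(1)=1$, then $\gamma_k(h)=\left(\sum_{n\in\mathbb{N}}|u(n)|^2\right)^{-1}$. Equivalently $-\gamma_k(h)$ is the residue at $\lambda_k$ of the Weyl $m$-function $m_h(z,g)=\langle e_1,(J_h(g)-z)^{-1}e_1\rangle$. Enumeration of two spectra. For $h_1\ne h_2$ the two spectra are disjoint, infinite and interlacing. Denote by $\{x_n\}_{n\in M}$ the spectrum for the larger of the two values $h_1,h_2$ and by $\{y_n\}_{n\in M}$ the spectrum for the smaller one (so if $h_1>h_2$ then $x_n=\lambda_n$, $y_n=\nu_n$, and if $h_1<h_2$ then $x_n=\nu_n$, $y_n=\lambda_n$). They are enumerated so that $x_n<y_n<x_{n+1}$ for $n\in M$ (whenever $n+1\in M$ for the last inequality), where: if $\inf x_n=-\infty$ and $\sup x_n=\infty$, then $M=\mathbb{Z}$ and $y_{-1}<0<x_1$; if $0<\sup x_n<\infty$,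 then $M=\{n\in\mathbb{Z}:n\le n_{max}\}$ with $n_{max}\ge1$ and $y_{-1}<0<x_1$; if $\sup x_n\le0$, then $M=\{n\in\mathbb{Z}:n\le0\}$; if $\inf y_n\ge0$, then $M=\{n\in\mathbb{Z}:n\ge0\}$; if $-\infty<\inf y_n<0$, then $M=\{n\in\mathbb{Z}:n\ge n_{min}\}$ with $n_{min}\le-1$ and $y_{-1}<0<x_1$. The same convention applies to the tilde operator with $\widetilde h_1,\widetilde h_2$. *)

(* Defs.v *)
From HB Require Import structures.
From mathcomp Require Import all_boot all_order all_algebra.
From mathcomp Require Import all_classical all_reals all_analysis.
From mathcomp Require Import complex.

Set Implicit Arguments.
Unset Strict Implicit.
Unset Printing Implicit Defensive.

Import Order.TTheory GRing.Theory Num.Theory.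
Import numFieldNormedType.Exports.
Import Normc.
Local Open Scope classical_set_scope.
Local Open Scope ring_scope.

(* Sequences are indexed by nat: the entry of index n stands for the entry
   of index n + 1 in the indexing by {1, 2, ...}.  So the coefficient a_1 is
   [a 0], b_1 is [b 0], and the normalization u(1) = 1 is [u 0 = 1]. *)

Section SequenceSpace.
Variable R : realType.
Implicit Types (f g : nat -> R[i]).

Definition in_l2 f : Prop := cvgn (series (fun n => normc (f n) ^+ 2)).

Definition l2sqnorm f : R := limn (series (fun n => normc (f n) ^+ 2)).

Definition l2norm f : R := Num.sqrt (l2sqnorm f).

(* Componentwise, as no topology on R[i] is at hand. *)
Definition csum (u : nat -> R[i]) : R[i] :=
  (limn (series (fun n => complex.Re (u n))) +i*
   limn (series (fun n => complex.Im (u n))))%C.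

Definition l2inner f g : R[i] := csum (fun n => f n * (g n)^*%C).

Definition e1 : nat -> R[i] := fun n => (n == 0%N)%:R.

End SequenceSpace.

Section Operators.
Variable R : realType.

(* Operators in l^2 are represented by their graphs. *)
Definition graph := set ((nat -> R[i]) * (nat -> R[i])).

Implicit Types T : graph.

Definition op_closure T : graph :=
  [set p | [/\ in_l2 p.1, in_l2 p.2 &
    exists F K : nat -> nat -> R[i],
      [/\ forall j, T (F j, K j),
          l2norm (F j \- p.1) @[j --> \oo] --> (0 : R) &
          l2norm (K j \- p.2) @[j --> \oo] --> (0 : R)]]].

Definition op_adjoint T : graph :=
  [set p | [/\ in_l2 p.1, in_l2 p.2 &
    forall f k, T (f, k) -> l2inner k p.1 = l2inner f p.2]].

Definition selfadjoint T : Prop := op_adjoint T = T.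

(* [T (f, fun n => k n + z * f n)] says that (T - z) f = k. *)
Definition resolvent_set T : set R[i] :=
  [set z |
    (forall k, in_l2 k -> exists! f, T (f, fun n => k n + z * f n)) /\
    (exists C : R, forall f k, T (f, k) ->
       l2norm f <= C * l2norm (fun n => k n - z * f n))].

Definition op_spectrum T : set R[i] := ~` resolvent_set T.

Definition eigenspace T (z : R[i]) : set (nat -> R[i]) :=
  [set f | T (f, fun n => z * f n)].

Definition is_eigenvalue T (z : R[i]) : Prop :=
  exists f, eigenspace T z f /\ exists n, f n != 0.

Definition finite_multiplicity T (z : R[i]) : Prop :=
  exists (d : nat) (e : 'I_d -> nat -> R[i]),
    forall f, eigenspace T z f ->
      exists c : 'I_d -> R[i], forall n, f n = \sum_(i < d) c i * e i n.

Definition isolated_in (S : set R[i]) (z : R[i]) : Prop :=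
  exists2 eps : R, 0 < eps & forall w, S w -> normc (w - z) < eps -> w = z.

Definition discrete_spectrum T : Prop :=
  forall z, op_spectrum T z ->
    [/\ is_eigenvalue T z, finite_multiplicity T z &
        isolated_in (op_spectrum T) z].

Definition is_norming_constant T (lam gam : R) : Prop :=
  exists u, [/\ eigenspace T lam%:C%C u, u 0%N = 1 & gam = (l2sqnorm u)^-1].

End Operators.

Section Jacobi.
Variable R : realType.
Implicit Types (a b : nat -> R) (f k : nat -> R[i]).

Definition tau a b f : nat -> R[i] := fun n =>
  (if n is m.+1 then (b m)%:C%C * f m else 0) +
  (a n)%:C%C * f n + (b n)%:C%C * f n.+1.

Definition Jmin a b : graph R :=
  [set p | (exists N : nat, forall n, (N <= n)%N -> p.1 n = 0) /\
           p.2 = tau a b p.1].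

Definition Jmax a b : graph R :=
  [set p | [/\ in_l2 p.1, in_l2 (tau a b p.1) & p.2 = tau a b p.1]].

Definition limit_point a b : Prop := selfadjoint (op_closure (Jmin a b)).

(* The inequality between J_min and its adjoint is meant up to closure. *)
Definition limit_circle a b : Prop := ~ limit_point a b.

(* The solution of b_(n-1) u_(n-1) + a_n u_n + b_n u_(n+1) = 0, n >= 2,
   with u(1) = p and u(2) = q. *)
Fixpoint zero_solution a b (p q : R) (n : nat) : R :=
  match n with
  | 0%N => p
  | m.+1 =>
    match m with
    | 0%N => q
    | l.+1 => - (b l * zero_solution a b p q l +
                 a m * zero_solution a b p q m) / b m
    end
  end.

Definition c0 a b : nat -> R := zero_solution a b 1 0.
Definition s0 a b : nat -> R := zero_solution a b 0 1.

Definition boundary_solution a b (alpha : R) : nat -> R[i] := fun n =>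
  (cos alpha * c0 a b n + sin alpha * s0 a b n)%:C%C.

Definition wronskian b f k : nat -> R[i] := fun n =>
  (b n)%:C%C * (f n * k n.+1 - k n * f n.+1).

(* Boundary conditions at infinity, i.e. elements of R plus a point at
   infinity, are elements of [option R], [None] being infinity. *)
Definition cot_ext (alpha : R) : option R :=
  if alpha == 0 then None else Some (cos alpha / sin alpha).

Definition jacobi a b (g : option R) : graph R :=
  if `[< limit_point a b >] then op_closure (Jmin a b)
  else [set p | Jmax a b p /\
         exists alpha : R, [/\ 0 <= alpha < pi, g = cot_ext alpha &
           normc (wronskian b (boundary_solution a b alpha) p.1 n) @[n --> \oo] --> (0 : R)]].

Definition jacobi_bc a b (h : R) (g : option R) : graph R :=
  [set p | exists k, jacobi a b g (p.1, k) /\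
    forall n, p.2 n = k n - h%:C%C * l2inner p.1 (@e1 R) * @e1 R n].

End Jacobi.

Section Enumeration.
Variable R : realType.

Definition interlacing_enumeration (M : set int) (x y : int -> R) : Prop :=
  let inf_x := ereal_inf [set (x n)%:E | n in M] in
  let sup_x := ereal_sup [set (x n)%:E | n in M] in
  let inf_y := ereal_inf [set (y n)%:E | n in M] in
  (forall n, M n -> x n < y n) /\
  (forall n, M n -> M (n + 1) -> y n < x (n + 1)) /\
  (inf_x = -oo%E -> sup_x = +oo%E -> M = setT /\ y (-1) < 0 < x 1) /\
  ((0 < sup_x < +oo)%E ->
     (exists2 nmax : int, 1 <= nmax & M = [set n | n <= nmax]) /\
     y (-1) < 0 < x 1) /\
  ((sup_x <= 0)%E -> M = [set n | n <= 0]) /\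
  ((0 <= inf_y)%E -> M = [set n | 0 <= n]) /\
  ((-oo < inf_y < 0)%E ->
     (exists2 nmin : int, nmin <= -1 & M = [set n | nmin <= n]) /\
     y (-1) < 0 < x 1).

(* [lam] and [nu] enumerate the spectra for the conditions [h1] and [h2] at
   the origin; the points for the larger condition play the role of x. *)
Definition two_spectra_enumeration
    (h1 h2 : R) (M : set int) (lam nu : int -> R) : Prop :=
  if h2 < h1 then interlacing_enumeration M lam nu
  else interlacing_enumeration M nu lam.

End Enumeration.

(* Main.v *)
(* With c = h1 - h2 and m the Weyl function of J_{h1}(g), the function
   F = 1 + c m = 1 + c sum_n gamma_n / (lambda_n - z) has poles lambda_n and
   zeros nu_n.  Dividing a zero and a pole out of F keeps this shape: for finite K,
     F(z) prod_{k in K} (z - lambda_k) / (z - nu_k) = 1 + c sum_n w_n / (lambda_n - z),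
   w_n = gamma_n prod_{k in K} (lambda_n - lambda_k) / (lambda_n - nu_k).
   Interlacing makes every w_n nonnegative, and their total is
   1 - sum_{k in K} (nu_k - lambda_k) / c <= 1.  Evaluate at lambda_n, n in K, where
   K increases to D = (M \ A) u {m}, and compare with the second operator: the
   terms outside D agree, and those left in D have total weight at most 1 and
   poles lambda_j running off to infinity.  In the limit n = m yields c = c~, and
   then every n in D yields gamma_n = gamma~_n.

   That m equals sum_n gamma_n / (lambda_n - z) rests on the completeness of the
   eigenvectors.  On the orthogonal complement of finitely many eigenvectors,
   J_{h1} - x is bounded below at the corresponding eigenvalues, because J_{h1}
   and J_{h2} agree on sequences whose first entry vanishes and the two spectra are
   disjoint; so the resolvent there has norm at most 1 / dist(x, remaining
   spectrum), which tends to 0.  The Jacobi coefficients are read off the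
   orthonormal polynomials of sum_n gamma_n delta_{lambda_n}. *)
Require Import Defs.
From HB Require Import structures.
From mathcomp Require Import all_boot all_order all_algebra.
From mathcomp Require Import all_classical all_reals all_analysis.
From mathcomp Require Import complex zify ring lra.

Set Implicit Arguments.
Unset Strict Implicit.
Unset Printing Implicit Defensive.

Import Order.TTheory GRing.Theory Num.Theory.
Import numFieldNormedType.Exports.
Import Normc.
Local Open Scope classical_set_scope.
Local Open Scope ring_scope.

(** * Convergent real series *)

Section Sums.
Variable R : realType.
Implicit Types (u w : nat -> R) (s t : R).

Definition sums u s : Prop := series u @ \oo --> s.

Lemma sumsD u w s t : sums u s -> sums w t -> sums (fun j => u j + w j) (s + t).
Proof.
move=> us wt; rewrite /sums (_ : series _ = series u \+ series w); first exact: cvgD.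
by apply/funext => n; rewrite /= !/(series _ _) /= big_split.
Qed.

Lemma sumsZ c u s : sums u s -> sums (fun j => c * u j) (c * s).
Proof.
move=> us; rewrite /sums (_ : series _ = (fun n => c * series u n)); first exact: cvgMl_tmp.
by apply/funext => n; rewrite /= !/(series _ _) /= mulr_sumr.
Qed.


Lemma sums_ext u w s : (forall j, u j = w j) -> sums u s -> sums w s.
Proof. by move=> /funext ->. Qed.

Lemma sums_unique u s t : sums u s -> sums u t -> s = t.
Proof. by move=> us ut; apply: (cvg_unique _ us ut). Qed.

Lemma sums1 (n : nat) (c : R) : sums (fun j => if j == n then c else 0) c.
Proof.
apply: cvg_near_cst; exists n.+1 => // m /= nm; rewrite /series /=.
rewrite big_mkord (bigD1 (Ordinal nm)) //= eqxx big1 ?addr0 // => i.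
by rewrite -val_eqE /= => /negbTE ->.
Qed.

Lemma sums_ge_partial u s n : (forall j, 0 <= u j) -> sums u s -> series u n <= s.
Proof.
move=> u0 us; have <- := cvg_lim (@Rhausdorff R) us.
apply: nondecreasing_cvgn_le; last by apply/cvg_ex; exists s.
by apply: nondecreasing_series => j _ _.
Qed.

Lemma sums_norm_le u w s t : (forall j, `|u j| <= w j) -> sums u s -> sums w t -> `|s| <= t.
Proof.
move=> uw us wt.
have w0 j : 0 <= w j by apply: le_trans (uw j).
have cvn : (fun n => `|series u n|) @ \oo --> `|s| by apply: cvg_norm.
rewrite -(cvg_lim (@Rhausdorff R) cvn); apply: limr_le; first by apply/cvg_ex; exists `|s|.
near=> n; apply: le_trans (sums_ge_partial n w0 wt).
by rewrite (le_trans (ler_norm_sum _ _ _)) // ler_sum.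
Unshelve. all: by end_near.
Qed.

End Sums.
Arguments sumsZ {R} c {u s} _.
Arguments sums1 {R} n c.

(** Data of [F(x) = 1 + c * sum_j gam j / (l j - x)]: [l] are its poles, [v] its zeros, [Mj] the
    indices in use, and [sd_zero] says [F (v k) = 0]. Interlacing is expressed through signs of
    quotients, so that both signs of [c] are covered at once. *)
Record spectral_data (R : realType) (Mj : pred nat) (l v : nat -> R) (c : R)
    (gam : nat -> R) : Prop := SpectralData {
  sd_c : c != 0;
  sd_sep : forall j k, Mj j -> Mj k -> j != k -> 0 < (l j - l k) / (l j - v k);
  sd_sgn : forall k, Mj k -> 0 < (v k - l k) / c;
  sd_out : forall j, ~~ Mj j -> gam j = 0;
  sd_ge0 : forall j, 0 <= gam j;
  sd_sum : sums gam 1;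
  sd_zero : forall k, Mj k -> sums (fun j => gam j / (l j - v k)) (- c^-1) }.

(** * Removing zeros and poles *)

Section PairRemoval.
Variables (R : realType) (Mj : pred nat) (l v : nat -> R) (c : R) (gam : nat -> R).
Hypothesis sd : spectral_data Mj l v c gam.
Let c0 := sd_c sd.
Let sep := sd_sep sd.
Let sgn := sd_sgn sd.
Let gam_out := sd_out sd.
Let gam_ge0 := sd_ge0 sd.
Let gam_sum := sd_sum sd.
Let gam_zero := sd_zero sd.

Lemma lv_neq j k : Mj j -> Mj k -> l j - v k != 0.
Proof.
move=> Mj_ Mk; have [->|jk] := eqVneq j k.
  by have := sgn Mk; apply: contraTneq => e; rewrite -opprB e oppr0 mul0r ltxx.
by have := sep Mj_ Mk jk; apply: contraTneq => ->; rewrite invr0 mulr0 ltxx.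
Qed.

Lemma ll_neq j k : Mj j -> Mj k -> j != k -> l j - l k != 0.
Proof.
by move=> Mj_ Mk jk; have := sep Mj_ Mk jk; apply: contraTneq => ->; rewrite mul0r ltxx.
Qed.

(** If [v j = v k = d], then [sd_sgn] makes [(d - l j) * (d - l k)] positive, while the product of
    the two quotients in [sd_sep] is [- (l j - l k) ^+ 2] divided by that same number, hence not
    positive. *)
Lemma vv_neq j k : Mj j -> Mj k -> j != k -> v j - v k != 0.
Proof.
move=> Mj_ Mk jk; apply/eqP => /eqP; rewrite subr_eq0 => /eqP e.
have kj : k != j by rewrite eq_sym.
have := sep Mj_ Mk jk; have := sep Mk Mj_ kj; have := sgn Mj_; have := sgn Mk.
rewrite e; set a := l j; set b := l k; set d := v k => H1 H2 H3 H4.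
have : 0 < ((d - b) / c) * ((d - a) / c) by rewrite mulr_gt0.
rewrite mulrACA -invfM -expr2 pmulr_lgt0 ?invr_gt0 ?exprn_even_gt0 // => H5.
have := mulr_gt0 H3 H4; rewrite mulrACA -invfM.
have -> : (b - a) * (a - b) = - (a - b) ^+ 2 by ring.
have -> : (b - d) * (a - d) = (d - b) * (d - a) by ring.
by rewrite pmulr_lgt0 ?invr_gt0 // oppr_gt0 ltNge sqr_ge0.
Qed.

(** Factor acquired by the weight at the pole [l j] when the poles [l k] and zeros [v k], [k] in
    [K], are divided out of [F]. *)
Definition removal_ratio (K : seq nat) (j : nat) : R :=
  \prod_(k <- K) ((l j - l k) / (l j - v k)).

Lemma removal_ratio_cons k K j :
  removal_ratio (k :: K) j = removal_ratio K j * ((l j - l k) / (l j - v k)).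
Proof. by rewrite /removal_ratio big_cons mulrC. Qed.

Lemma removal_ratio_mem K j : j \in K -> removal_ratio K j = 0.
Proof.
elim: K => // k K IH; rewrite removal_ratio_cons inE => /orP[/eqP ->|/IH ->].
  by rewrite subrr mul0r mulr0.
by rewrite mul0r.
Qed.

Lemma removal_ratio_ge0 K j : Mj j -> all Mj K -> 0 <= removal_ratio K j.
Proof.
move=> Mj_; elim: K => [_|k K IH]; first by rewrite /removal_ratio big_nil ler01.
rewrite removal_ratio_cons => /= /andP[Mk /IH K0]; rewrite mulr_ge0 //.
have [->|jk] := eqVneq j k; first by rewrite subrr mul0r.
exact/ltW/sep.
Qed.

Lemma removal_ratio_gt0 K j : Mj j -> all Mj K -> j \notin K -> 0 < removal_ratio K j.
Proof.
move=> Mj_; elim: K => [_ _|k K IH]; first by rewrite /removal_ratio big_nil ltr01.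
rewrite removal_ratio_cons inE negb_or => /= /andP[Mk MK] /andP[jk jK].
by rewrite mulr_gt0 ?IH // sep.
Qed.

Let w K j := gam j * removal_ratio K j.

(* Dividing a zero and a pole out of F(x) = 1 + c sum_j w_j / (l_j - x) keeps
   that shape: partial fractions with F(v_k) = 0. *)
Lemma removal_sums K : uniq K -> all Mj K ->
  sums (w K) (1 - \sum_(k <- K) (v k - l k) / c) /\
  forall k, Mj k -> k \notin K -> sums (fun j => w K j / (l j - v k)) (- c^-1).
Proof.
elim: K => [_ _|n K IH] /=.
  rewrite big_nil subr0; split=> [|k Mk _].
    by apply: sums_ext gam_sum => j; rewrite /w /removal_ratio big_nil mulr1.
  by apply: sums_ext (gam_zero Mk) => j; rewrite /w /removal_ratio big_nil mulr1.
move=> /andP[nK uK] /andP[Mn MK]; have [IH1 IH2] := IH uK MK.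
(* Uses [(l j - l n) / (l j - v n) = 1 + (v n - l n) / (l j - v n)]. *)
have wE j : w (n :: K) j = w K j + (v n - l n) * (w K j / (l j - v n)).
  rewrite /w removal_ratio_cons; have [Mj_|nMj] := boolP (Mj j); last first.
    by rewrite gam_out // !mul0r mulr0 addr0.
  by have := lv_neq Mj_ Mn => h; field.
split=> [|k Mk].
  apply: sums_ext (fun j => esym (wE j)) _; rewrite big_cons.
  have := sumsD IH1 (sumsZ (v n - l n) (IH2 n Mn nK)).
  by congr (sums _ _); ring.
rewrite inE negb_or => /andP[kn kK].
have S := IH2 _ Mk kK; have Sn := IH2 _ Mn nK.
have d : v n - v k != 0 by apply: vv_neq; rewrite // eq_sym.
(* The product of [1 / (l j - v n)] and [1 / (l j - v k)] is their difference over [v n - v k]; both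
   series sum to [- c^-1], so the correction cancels. *)
have := sumsD S (sumsZ ((v n - l n) / (v n - v k)) (sumsD Sn (sumsZ (-1) S))).
have -> : - c^-1 + (v n - l n) / (v n - v k) * (- c^-1 + -1 * - c^-1) = - c^-1 by ring.
apply: sums_ext => j; rewrite wE.
have [Mj_|nMj] := boolP (Mj j); last by rewrite /w gam_out // !mul0r; ring.
by have h1 := lv_neq Mj_ Mn; have h2 := lv_neq Mj_ Mk; field; rewrite d h1 h2.
Qed.

Lemma removal_total_le1 K s : uniq K -> all Mj K -> sums (w K) s -> s <= 1.
Proof.
move=> uK MK /sums_unique/(_ (removal_sums uK MK).1) ->.
rewrite gerBl; elim: K MK {uK} => [|k K IH] /=; first by rewrite big_nil.
by rewrite big_cons => /andP[/sgn/ltW ? /IH ?]; rewrite addr_ge0.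
Qed.

(** The weight left after the removal totals 1 minus this sum, and it is nonnegative because every
    single weight is. *)
Lemma removal_gap_sum_le1 K : uniq K -> all Mj K -> \sum_(k <- K) (v k - l k) / c <= 1.
Proof.
move=> uK MK; rewrite -subr_ge0.
have /(sums_ge_partial 0) := (removal_sums uK MK).1.
rewrite /series /= big_geq //; apply => j; rewrite /w.
have [Mj_|nMj] := boolP (Mj j); first by rewrite mulr_ge0 // removal_ratio_ge0.
by rewrite gam_out ?mul0r.
Qed.

(** For [j != n] the term equals [gam j * removal_ratio K j / (l j - v n)]. So the series is the one
    with sum [- c^-1] at the zero [v n], without its term [j = n]; on the left that term is 0
    because the ratio vanishes. *)
Lemma removal_eval n K : uniq (n :: K) -> all Mj (n :: K) ->
  sums (fun j => gam j * (removal_ratio (n :: K) j / (l j - l n)))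
       (- c^-1 + gam n * (removal_ratio K n / (v n - l n))).
Proof.
move=> /= /andP[nK uK] /andP[Mn MK].
have := sumsD ((removal_sums uK MK).2 _ Mn nK)
  (sums1 n (gam n * (removal_ratio K n / (v n - l n)))).
apply: sums_ext => j; rewrite /w removal_ratio_cons.
have [->|jn] := eqVneq j n.
  by rewrite !subrr mul0r !mulr0 mul0r mulr0 -opprB invrN !mulrN mulrA addNr.
have [Mj_|nMj] := boolP (Mj j); last by rewrite gam_out // !mul0r addr0.
by have h1 := lv_neq Mj_ Mn; have h2 := ll_neq Mj_ Mn jn; field; rewrite h1 h2.
Qed.

End PairRemoval.

Section PairRemovalBounds.
Variables (R : realType) (Mj : pred nat) (l : nat -> R).
Hypothesis escape : forall C : R, exists N, forall j, (N <= j)%N -> Mj j -> C < `|l j|.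

Lemma pole_gap n : (forall j, Mj j -> j != n -> l j != l n) ->
  exists2 d, 0 < d & forall j, Mj j -> j != n -> d <= `|l j - l n|.
Proof.
move=> inj; have [N HN] := escape (`|l n| + 1).
have {}HN j : (N <= j)%N -> Mj j -> 1 <= `|l j - l n|.
  by move=> /HN/[apply] h; have := lerB_dist (l j) (l n); lra.
(* The tail [N <= j] has gap at least 1; the finitely many earlier indices enter one by one through
   a minimum. *)
suff H k : exists2 d, 0 < d & forall j, ((N <= j) || (j < k))%N -> Mj j -> j != n ->
    d <= `|l j - l n|.
  by have [d d0 Hd] := H N; exists d => // j; apply: Hd; rewrite leqNgt orNb.
elim: k => [|k [d d0 Hd]]; first by exists 1 => // j /orP[/HN h /h|].
have [/andP[Mk kn]|nk] := boolP (Mj k && (k != n)); last first.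
  exists d => // j /orP[jN|]; first by apply: Hd; rewrite jN.
  rewrite ltnS leq_eqVlt => /orP[/eqP ->{j}|jk]; last by apply: Hd; rewrite jk orbT.
  by move=> Mk kn; rewrite Mk kn in nk.
exists (Num.min d `|l k - l n|) => [|j]; first by rewrite lt_min d0 normr_gt0 subr_eq0 inj.
move=> /orP[jN|]; first by move=> Mj_ jn; rewrite ge_min Hd // jN.
rewrite ltnS leq_eqVlt => /orP[/eqP ->{j}|jk] Mj_ jn; first by rewrite ge_min lexx orbT.
by rewrite ge_min Hd // jk orbT.
Qed.

Lemma pole_escape n C : exists N, forall j, (N <= j)%N -> Mj j -> C <= `|l j - l n|.
Proof.
have [N HN] := escape (`|l n| + C); exists N => j /HN/[apply] h.
by have := lerB_dist (l j) (l n); lra.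
Qed.

End PairRemovalBounds.

(** * Comparison of two sets of spectral data *)

Section Comparison.
Variables (R : realType) (Mj D : pred nat) (l v v' : nat -> R) (c c' : R).
Variables (gam gam' : nat -> R).
Hypothesis sd : spectral_data Mj l v c gam.
Hypothesis sd' : spectral_data Mj l v' c' gam'.
Hypothesis escape : forall C : R, exists N, forall j, (N <= j)%N -> Mj j -> C < `|l j|.
Hypothesis DM : forall j, D j -> Mj j.
Hypothesis eq_v : forall j, D j -> v j = v' j.
Hypothesis eq_gam : forall j, Mj j -> ~~ D j -> gam j = gam' j.

Lemma eq_removal_ratio K j : all D K -> removal_ratio l v K j = removal_ratio l v' K j.
Proof.
by move=> /allP DK; apply: eq_big_seq => k /DK Dk; rewrite eq_v.
Qed.

(** The reciprocal is a product of factors [1 + (l k - v k) / (l n - l k)], each at most the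
    exponential of [|v k - l k| / d], where [d] bounds the distance from [l n] to the other poles
    from below. The gaps [|v k - l k|] sum to at most [|c|], so the bound is uniform in [K]. *)
Lemma removal_ratio_lb n : D n -> exists2 t, 0 < t & forall K, uniq (n :: K) ->
  all D K -> t <= removal_ratio l v K n.
Proof.
move=> Dn; have Mn := DM Dn.
have [] := pole_gap escape (n := n) => [j Mj_ jn|d d0 Hd].
  by rewrite -subr_eq0; apply: (ll_neq sd).
exists (expR (`|c| / d))^-1 => [|K]; first by rewrite invr_gt0 expR_gt0.
move=> /= /andP[nK uK] DK; have MK : all Mj K by apply: sub_all DK.
have r0 := removal_ratio_gt0 sd Mn MK nK.
rewrite -[leRHS]invrK lef_pV2 ?posrE ?invr_gt0 ?expR_gt0 //.
have le1 := removal_gap_sum_le1 sd uK MK.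
apply: (@le_trans _ _ (expR (`|c| / d * \sum_(k <- K) (v k - l k) / c))); last first.
  by rewrite ler_expR ler_piMr // divr_ge0 // ltW.
rewrite mulr_sumr expR_sum /removal_ratio -prodfV !big_seq; apply: ler_prod => k kK.
have Mk := allP MK _ kK.
have nk : n != k by apply: contraNneq nK => ->.
have kn : k != n by rewrite eq_sym.
rewrite invr_ge0 (ltW (sd_sep sd Mn Mk nk)) invf_div /=.
have h := ll_neq sd Mn Mk nk.
apply: le_trans (expR_ge1Dx _).
have -> : (l n - v k) / (l n - l k) = 1 + (l k - v k) / (l n - l k) by field.
rewrite lerD2l; apply: le_trans (ler_norm _) _.
have -> : `|c| / d * ((v k - l k) / c) = `|v k - l k| / d.
  rewrite mulrAC; congr (_ / d).
  by rewrite -(gtr0_norm (sd_sgn sd Mk)) normrM normfV mulrCA divff ?mulr1 ?normr_eq0 ?(sd_c sd).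
rewrite normrM normfV distrC ler_wpM2l // lef_pV2 ?posrE ?normr_gt0 // distrC; exact: Hd.
Qed.

(** The two identities of [removal_eval] are subtracted. Terms off [D] cancel since ratios and
    weights agree there, terms in [n :: K] vanish, and the others have poles far from [l n]. *)
Lemma spectral_data_compare n (eps : R) : D n -> 0 < eps -> exists K, [/\ uniq (n :: K), all D K &
  `|c'^-1 - c^-1 + (gam n - gam' n) * (removal_ratio l v K n / (v n - l n))| <= eps].
Proof.
move=> Dn eps0; have Mn := DM Dn.
(* The two total weights add up to at most 2, so poles at distance at least [2 / eps] contribute at
   most [eps]. *)
have [N HN] := pole_escape escape n (2 / eps).
pose K := [seq k <- iota 0 N | D k && (k != n)].
have uK : uniq (n :: K) by rewrite /= mem_filter eqxx andbF filter_uniq ?iota_uniq.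
have DK : all D K by apply/allP => k; rewrite mem_filter => /andP[/andP[]].
have DnK : all D (n :: K) by rewrite /= Dn.
have MnK : all Mj (n :: K) by apply: sub_all DnK.
exists K; split=> //.
have E := removal_eval sd uK MnK.
have E' := removal_eval sd' uK MnK.
have [T _] := removal_sums sd uK MnK.
have [T' _] := removal_sums sd' uK MnK.
have le1 := removal_total_le1 sd uK MnK T.
have le1' := removal_total_le1 sd' uK MnK T'.
have S := sumsD E (sumsZ (-1) E').
have B := sumsZ (eps / 2) (sumsD T T').
have := sums_norm_le _ S B.
rewrite -!(eq_removal_ratio _ DK) -!(eq_v Dn) => H.
apply: (@le_trans _ _ (eps / 2 * (1 + 1))); last by rewrite mulrDr mulr1 -splitr.
apply: le_trans (_ : _ <= eps / 2 * (_ + _)) _; last first.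
  by apply: ler_wpM2l (lerD le1 le1'); rewrite divr_ge0 ?ltW.
apply: le_trans (H _); first by rewrite le_eqVlt; apply/orP; left; apply/eqP; congr (`|_|); ring.
move=> j; rewrite -!(eq_removal_ratio _ DnK).
have [Mj_|nMj] := boolP (Mj j); last first.
  by rewrite (sd_out sd) // (sd_out sd') // !mul0r mulr0 addr0 mulr0 normr0.
have r0 := removal_ratio_ge0 sd Mj_ MnK.
have g0 := sd_ge0 sd j; have g0' := sd_ge0 sd' j.
have [nDj|Dj] := boolP (~~ D j).
  rewrite (eq_gam Mj_ nDj) mulN1r subrr normr0.
  by apply: mulr_ge0; [rewrite divr_ge0 ?ltW | rewrite addr_ge0 ?mulr_ge0].
have [jK|jK] := boolP (j \in n :: K).
  by rewrite removal_ratio_mem // !mul0r !mulr0 addr0 mulr0 normr0.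
have {}HN : 2 / eps <= `|l j - l n|.
  apply: HN => //; rewrite leqNgt; apply: contra jK => jN.
  by rewrite inE; case: eqP => //= /eqP jn; rewrite mem_filter mem_iota jn (negbNE Dj).
have lj0 : 0 < `|l j - l n| by apply: lt_le_trans HN; rewrite divr_gt0.
have -> : gam j * (removal_ratio l v (n :: K) j / (l j - l n)) +
  -1 * (gam' j * (removal_ratio l v (n :: K) j / (l j - l n))) =
  (gam j - gam' j) * removal_ratio l v (n :: K) j / (l j - l n) by ring.
rewrite !normrM normfV (ger0_norm r0) mulrC ler_pM //.
- by rewrite mulr_ge0.
- by rewrite -[eps / 2]invf_div lef_pV2 ?posrE ?divr_gt0.
- rewrite -mulrDl ler_wpM2r //; apply: le_trans (ler_normB _ _) _.
  by rewrite !ger0_norm.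
Qed.

Theorem spectral_data_unique m : D m -> gam m = gam' m -> c = c' /\ gam =1 gam'.
Proof.
(* At [n = m] the weights agree, and only the difference of the inverses of [c] and [c'] is left,
   smaller than any [e]. *)
move=> Dm gm; have cc : c = c'.
  apply: invr_inj; apply/esym/eqP; rewrite -subr_eq0 -normr_le0; apply/ler_addgt0Pl => e e0.
  have [K [_ _]] := spectral_data_compare Dm e0.
  by rewrite gm subrr mul0r !addr0 ?add0r.
split=> // j; have [Dj|nDj] := boolP (D j); last first.
  have [Mj_|nMj] := boolP (Mj j); first exact: eq_gam.
  by rewrite (sd_out sd) // (sd_out sd').
apply/eqP; rewrite -subr_eq0; apply/negPn/negP; rewrite -normr_gt0 => g0.
have [t t0 Ht] := removal_ratio_lb Dj.
have vl : 0 < `|v j - l j|.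
  by rewrite normr_gt0 -opprB oppr_eq0 (lv_neq sd) ?DM.
(* Half of the lower bound that [removal_ratio_lb] gives for the compared quantity; being at most
   this half is absurd. *)
have e0 : 0 < `|gam j - gam' j| * (t / `|v j - l j|) / 2 by rewrite !(divr_gt0, mulr_gt0).
have [K [uK DK]] := spectral_data_compare Dj e0.
rewrite -cc subrr add0r normrM leNgt => /negP; apply.
rewrite !normrM normfV; apply: lt_le_trans (_ : `|gam j - gam' j| * (t / `|v j - l j|) <= _).
  by rewrite ltr_pdivrMr // mulr_natr mulr2n ltrDl mulr_gt0 ?divr_gt0.
rewrite ler_pM2l // ler_wpM2r ?invr_ge0 //; apply: le_trans (Ht K uK DK) (ler_norm _).
Qed.

End Comparison.

(** * The Hilbert space of square-summable sequences *)

Section SequenceSpaceTheory.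
Variable R : realType.
Implicit Types (f g k u w : nat -> R[i]) (c z : R[i]).

Arguments normc : simpl never.

Lemma normc_sqr z : normc z ^+ 2 = complex.Re z ^+ 2 + complex.Im z ^+ 2.
Proof. by case: z => x y /=; rewrite sqr_sqrtr // addr_ge0 ?sqr_ge0. Qed.

Lemma ReD z c : complex.Re (z + c) = complex.Re z + complex.Re c.
Proof. by case: z; case: c. Qed.

Lemma ImD z c : complex.Im (z + c) = complex.Im z + complex.Im c.
Proof. by case: z; case: c. Qed.

Lemma ReM z c :
  complex.Re (z * c) = complex.Re z * complex.Re c - complex.Im z * complex.Im c.
Proof. by case: z; case: c. Qed.

Lemma ImM z c :
  complex.Im (z * c) = complex.Re z * complex.Im c + complex.Im z * complex.Re c.
Proof. by case: z; case: c. Qed.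

Lemma conjcM z c : (z * c)^*%C = z^*%C * c^*%C.
Proof. by case: z => a b; case: c => a' b'; congr (_ +i* _)%C; ring. Qed.

Lemma conjcD z c : (z + c)^*%C = z^*%C + c^*%C.
Proof. by case: z => a b; case: c => a' b'; congr (_ +i* _)%C; ring. Qed.

Lemma conjc_real (x : R) : (x%:C)^*%C = x%:C%C.
Proof. by congr (_ +i* _)%C; rewrite oppr0. Qed.

Lemma conjc0E : (0 : R[i])^*%C = 0.
Proof. exact: (conjc_real 0). Qed.

Lemma complex_eqP z c : complex.Re z = complex.Re c -> complex.Im z = complex.Im c -> z = c.
Proof. by case: z => a b; case: c => a' b' /= -> ->. Qed.

Lemma sqrD_le (x y : R) : (x + y) ^+ 2 <= 2 * x ^+ 2 + 2 * y ^+ 2.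
Proof.
rewrite -subr_ge0 (_ : _ - _ = (x - y) ^+ 2); first exact: sqr_ge0.
by ring.
Qed.

Lemma normc_sqrD z c : normc (z + c) ^+ 2 <= 2 * normc z ^+ 2 + 2 * normc c ^+ 2.
Proof.
rewrite !normc_sqr ReD ImD.
have := sqrD_le (complex.Re z) (complex.Re c).
by have := sqrD_le (complex.Im z) (complex.Im c); lra.
Qed.

Lemma in_l2_lin f g c : in_l2 f -> in_l2 g -> in_l2 (fun n => f n + c * g n).
Proof.
move=> lf lg; rewrite /in_l2.
apply: (@series_le_cvg _ _ (fun n => 2 * normc (f n) ^+ 2 +
    2 * normc c ^+ 2 * normc (g n) ^+ 2)) => [n|n|n|].
- exact: sqr_ge0.
- by rewrite !(sqr_ge0, addr_ge0, mulr_ge0).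
- by rewrite -mulrA -exprMn -normcM normc_sqrD.
have /cvg_ex[s fs] := lf; have /cvg_ex[t gt] := lg.
apply/cvg_ex; eexists; exact: sumsD (sumsZ 2 fs) (sumsZ (2 * normc c ^+ 2) gt).
Qed.

Local Arguments in_l2_lin {f g} c _ _.

Lemma in_l2_0 : in_l2 (fun=> 0 : R[i]).
Proof.
apply/cvg_ex; exists 0; apply: cvg_near_cst; near=> n; rewrite /series /=.
by apply: big1 => i _; rewrite normc_sqr /= expr0n addr0.
Unshelve. all: by end_near.
Qed.

Lemma in_l2Z f c : in_l2 f -> in_l2 (fun n => c * f n).
Proof.
move=> lf; rewrite (_ : (fun _ => _) = fun n => 0 + c * f n); first exact/in_l2_lin/lf/in_l2_0.
by apply/funext => n; rewrite add0r.
Qed.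

Local Arguments in_l2Z {f} c _.

Definition csummable u : Prop :=
  cvgn (series (fun n => complex.Re (u n))) /\ cvgn (series (fun n => complex.Im (u n))).

Lemma csum_lin u w c : csummable u -> csummable w ->
  csum (fun n => u n + c * w n) = csum u + c * csum w.
Proof.
move=> [/cvg_ex[a Ha] /cvg_ex[b Hb]] [/cvg_ex[a' Ha'] /cvg_ex[b' Hb']].
have L (s : R) (v : nat -> R) : series v @ \oo --> s -> limn (series v) = s by apply: cvg_lim.
rewrite /csum (L _ _ Ha) (L _ _ Hb) (L _ _ Ha') (L _ _ Hb').
apply: complex_eqP => /=; rewrite ?ReD ?ImD ?ReM ?ImM /=; apply: L.
- have := sumsD Ha (sumsD (sumsZ (complex.Re c) Ha') (sumsZ (- complex.Im c) Hb')).
  by rewrite -mulNr; apply: sums_ext => j; rewrite ReD ReM mulNr.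
- have := sumsD Hb (sumsD (sumsZ (complex.Re c) Hb') (sumsZ (complex.Im c) Ha')).
  by apply: sums_ext => j; rewrite ImD ImM.
Qed.

Lemma l2inner_csummable f g : in_l2 f -> in_l2 g -> csummable (fun n => f n * (g n)^*%C).
Proof.
move=> /cvg_ex[s fs] /cvg_ex[t gt].
have dom (v : nat -> R) : (forall n, `|v n| <= normc (f n) ^+ 2 + normc (g n) ^+ 2) ->
    cvgn (series v).
  move=> H; apply: (@normed_cvg R R); apply: (@series_le_cvg _ _ _ _ _ H).
  - by move=> n; rewrite normr_ge0.
  - by move=> n; rewrite addr_ge0 ?sqr_ge0.
  by apply/cvg_ex; exists (s + t); apply: sumsD fs gt.
split; apply: dom => n; rewrite ?ReM ?ImM !normc_sqr; case: (f n) => a b; case: (g n) => a' b' /=;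
  (* These squares bound each product in the real and imaginary parts by half the sum of the squares
     of its factors. *)
  have h := (sqr_ge0 (a + a'), sqr_ge0 (a - a'), sqr_ge0 (b + b'), sqr_ge0 (b - b'),
    sqr_ge0 (a + b'), sqr_ge0 (a - b'), sqr_ge0 (b + a'), sqr_ge0 (b - a'));
  move: h => [[[[[[[h1 h2] h3] h4] h5] h6] h7] h8];
  by rewrite ler_norml; apply/andP; split; lra.
Qed.

Lemma l2inner_linl f g k c : in_l2 f -> in_l2 g -> in_l2 k ->
  l2inner (fun n => f n + c * g n) k = l2inner f k + c * l2inner g k.
Proof.
move=> lf lg lk; rewrite /l2inner -csum_lin; try exact: l2inner_csummable.
by congr csum; apply/funext => n; rewrite mulrDl mulrA.
Qed.

Lemma l2inner_conj f g : in_l2 f -> in_l2 g -> l2inner g f = (l2inner f g)^*%C.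
Proof.
move=> lf lg; have [/cvg_ex[a Ha] /cvg_ex[b Hb]] := l2inner_csummable lf lg.
have L (s : R) (v : nat -> R) : series v @ \oo --> s -> limn (series v) = s by apply: cvg_lim.
rewrite /l2inner /csum (L _ _ Ha) (L _ _ Hb); apply: complex_eqP => /=; apply: L.
  by apply: sums_ext Ha => j; case: (f j) => ? ?; case: (g j) => ? ? /=; ring.
by rewrite -mulN1r; apply: sums_ext (sumsZ (-1) Hb) => j;
  case: (f j) => ? ?; case: (g j) => ? ? /=; ring.
Qed.

Lemma l2inner_linr f g k c : in_l2 f -> in_l2 g -> in_l2 k ->
  l2inner k (fun n => f n + c * g n) = l2inner k f + c^*%C * l2inner k g.
Proof.
move=> lf lg lk; rewrite (l2inner_conj (in_l2_lin c lf lg) lk) (l2inner_linl c lf lg lk).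
by rewrite conjcD conjcM -(l2inner_conj lf lk) -(l2inner_conj lg lk).
Qed.

Lemma l2sqnormP f : in_l2 f -> sums (fun n => normc (f n) ^+ 2) (l2sqnorm f).
Proof. by move=> lf; apply: lf. Qed.

Lemma l2innerff f : in_l2 f -> l2inner f f = (l2sqnorm f)%:C%C.
Proof.
move=> lf; rewrite /l2inner /csum /l2sqnorm; apply: complex_eqP => /=.
  congr (limn (series _)); apply/funext => n; rewrite normc_sqr.
  by case: (f n) => a b /=; ring.
rewrite (_ : series _ = cst 0) ?lim_cst //; apply/funext => n; rewrite /series /=.
by apply: big1 => i _; case: (f i) => a b /=; ring.
Qed.

Lemma l2sqnorm_ge_partial f n : in_l2 f -> series (fun n => normc (f n) ^+ 2) n <= l2sqnorm f.
Proof. by move=> /l2sqnormP; apply: sums_ge_partial => j; apply: sqr_ge0. Qed.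

Lemma l2sqnorm_ge0 f : in_l2 f -> 0 <= l2sqnorm f.
Proof. by move=> /(l2sqnorm_ge_partial 0); rewrite /series /= big_geq. Qed.

Lemma normc_le_l2sqnorm f n : in_l2 f -> normc (f n) ^+ 2 <= l2sqnorm f.
Proof.
move=> /(l2sqnorm_ge_partial n.+1); apply: le_trans; rewrite /series /= big_nat_recr //=.
by rewrite lerDr sumr_ge0 // => i _; rewrite sqr_ge0.
Qed.

Lemma l2norm_sqr f : in_l2 f -> l2norm f ^+ 2 = l2sqnorm f.
Proof. by move=> /l2sqnorm_ge0 ?; rewrite /l2norm sqr_sqrtr. Qed.

Lemma l2sqnorm_lin f g c : in_l2 f -> in_l2 g -> l2sqnorm (fun n => f n + c * g n) =
  l2sqnorm f + 2 * complex.Re (c * l2inner g f) + normc c ^+ 2 * l2sqnorm g.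
Proof.
move=> lf lg; have l := in_l2_lin c lf lg.
have /(congr1 (@complex.Re R)) := l2innerff l; rewrite (l2inner_linl c lf lg l).
rewrite (l2inner_linr c lf lg lf) (l2inner_linr c lf lg lg) (l2inner_conj lg lf) !l2innerff //.
case: (l2inner g f) => a b; case: c {l} => x y /= <-; rewrite normc_sqr /=; ring.
Qed.

Lemma l2sqnormZ f c : in_l2 f -> l2sqnorm (fun n => c * f n) = normc c ^+ 2 * l2sqnorm f.
Proof.
move=> lf; apply: (sums_unique (l2sqnormP (in_l2Z c lf))).
by apply: sums_ext (sumsZ _ (l2sqnormP lf)) => j; rewrite normcM exprMn.
Qed.

End SequenceSpaceTheory.
Arguments in_l2_lin {R f g} c _ _.
Arguments in_l2Z {R f} c _.

Section CoordinatesAndBounds.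
Variable R : realType.
Implicit Types (f g k : nat -> R[i]) (c : R[i]).

Arguments normc : simpl never.

Lemma l2innerZl g k c : in_l2 g -> in_l2 k -> l2inner (fun n => c * g n) k = c * l2inner g k.
Proof.
move=> lg lk; rewrite (_ : (fun n => _) = fun n => g n + (c - 1) * g n).
  by rewrite l2inner_linl //; ring.
by apply/funext => n; ring.
Qed.

Lemma l2innerZr g k c : in_l2 g -> in_l2 k -> l2inner k (fun n => c * g n) = c^*%C * l2inner k g.
Proof.
move=> lg lk; rewrite (l2inner_conj _ lk); last exact: in_l2Z.
by rewrite l2innerZl // conjcM -l2inner_conj.
Qed.

Definition delta (i : nat) : nat -> R[i] := fun n => (n == i)%:R.

Lemma finsupp_in_l2 f (N : nat) : (forall n, (N <= n)%N -> f n = 0) -> in_l2 f.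
Proof.
move=> fN; apply/cvg_ex; exists (series (fun n => normc (f n) ^+ 2) N).
apply: cvg_near_cst; exists N => // n /= Nn.
rewrite /series /= (big_cat_nat (n := N)) //= [X in _ + X]big_nat_cond.
rewrite [X in _ + X]big1 ?addr0 // => i.
by rewrite andbT => /andP[/fN -> _]; rewrite normc_sqr /= expr0n addr0.
Qed.

Lemma delta_in_l2 i : in_l2 (delta i).
Proof.
by apply: (@finsupp_in_l2 _ i.+1) => n; rewrite /delta; case: eqP => // ->; rewrite ltnn.
Qed.

Local Arguments delta_in_l2 i : clear implicits.

Lemma l2inner_delta f i : l2inner f (delta i) = f i.
Proof.
have L (s : R) (v : nat -> R) : series v @ \oo --> s -> limn (series v) = s by apply: cvg_lim.
rewrite /l2inner /csum; apply: complex_eqP => /=; apply: L.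
  apply: sums_ext (sums1 i (complex.Re (f i))) => j; rewrite /delta.
  by case: eqP => [->|_]; case: (f _) => a b /=; ring.
apply: sums_ext (sums1 i (complex.Im (f i))) => j; rewrite /delta.
by case: eqP => [->|_]; case: (f _) => a b /=; ring.
Qed.

Lemma l2inner_deltal f i : in_l2 f -> l2inner (delta i) f = (f i)^*%C.
Proof. by move=> lf; rewrite (l2inner_conj lf (delta_in_l2 i)) l2inner_delta. Qed.

Lemma l2sqnorm_eq0 f : in_l2 f -> l2sqnorm f <= 0 -> f = fun=> 0.
Proof.
move=> lf f0; apply/funext => n; apply: eq0_normc; apply/eqP; rewrite -sqrf_eq0.
by rewrite eq_le sqr_ge0 (le_trans (normc_le_l2sqnorm n lf)).
Qed.

Lemma l2sqnorm_lin_le f g c : in_l2 f -> in_l2 g ->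
  l2sqnorm (fun n => f n + c * g n) <= 2 * l2sqnorm f + 2 * normc c ^+ 2 * l2sqnorm g.
Proof.
move=> lf lg; have h := l2sqnorm_ge0 (in_l2_lin (- c) lf lg).
move: h; rewrite !l2sqnorm_lin //.
have -> : complex.Re (- c * l2inner g f) = - complex.Re (c * l2inner g f).
  by rewrite !ReM; case: c => x y /=; ring.
have -> : normc (- c) ^+ 2 = normc c ^+ 2 by rewrite !normc_sqr; case: c => x y /=; ring.
lra.
Qed.

(** [r] is the supremum of [p i / q i] over [q i > 0]; where [q i = 0], the bound by [B] already
    gives [p i <= 0]. The last clause supplies near-maximizers. *)
Lemma sup_ratio (I : Type) (P : I -> Prop) (p q : I -> R) (B : R) :
  (forall i, P i -> 0 <= q i) -> (forall i, P i -> p i <= B * q i) ->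
  forall i0, P i0 -> 0 < q i0 -> exists r, [/\ p i0 <= r * q i0,
    forall i, P i -> p i <= r * q i &
    forall e, 0 < e -> exists i, [/\ P i, 0 < q i & (r - e) * q i < p i]].
Proof.
move=> q0 pB i0 Pi0 qi0; pose A := [set p i / q i | i in [set i | P i /\ 0 < q i]].
have supA : has_sup A.
  split; first by exists (p i0 / q i0), i0.
  by exists B => _ [i [Pi qi] <-]; rewrite ler_pdivrMr // pB.
have le i : P i -> p i <= sup A * q i.
  move=> Pi; have := q0 _ Pi; rewrite le_eqVlt => /orP[/eqP qi|qi].
    by rewrite -qi mulr0 (le_trans (pB _ Pi)) // -qi mulr0.
  by rewrite -ler_pdivrMr //; apply: sup_upper_bound => //; exists i.
exists (sup A); split=> [||e e0]; [exact: le|exact: le|].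
have [_ [i [Pi qi] <-] lt] := sup_adherent e0 supA.
by exists i; split=> //; rewrite -ltr_pdivlMr.
Qed.

(* With r the best constant in |S f|^2 <= r |f|^2, maximizing sequences are
   approximate eigenvectors of S^2 for the eigenvalue r. *)
Lemma symmetric_bound (H : set (nat -> R[i])) (S : (nat -> R[i]) -> nat -> R[i]) (B E : R) :
  (forall f, H f -> in_l2 f) -> (forall f, H f -> H (S f)) ->
  (forall f g, H f -> H g -> l2inner (S f) g = l2inner f (S g)) ->
  (forall f, H f -> l2sqnorm (S f) <= B * l2sqnorm f) -> 0 < E ->
  (forall r, E < r -> exists K, forall f, H f ->
     l2sqnorm f <= K * l2sqnorm (fun n => S (S f) n + (- r)%:C%C * f n)) ->
  forall f, H f -> l2sqnorm (S f) <= E * l2sqnorm f.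
Proof.
move=> Hl2 HS Ssym SB E0 HE f Hf; rewrite leNgt; apply/negP => lt.
have f0 : 0 < l2sqnorm f.
  have := l2sqnorm_ge0 (Hl2 _ Hf); rewrite le_eqVlt => /orP[/eqP e|//].
  by have := SB _ Hf; rewrite -e mulr0 leNgt (le_lt_trans _ lt) // -e mulr0.
have [r [fr ler Hr]] := sup_ratio (P := H) (p := fun f => l2sqnorm (S f)) (q := @l2sqnorm R)
  (fun g Hg => l2sqnorm_ge0 (Hl2 g Hg)) SB Hf f0.
have Er : E < r by rewrite -(ltr_pM2r f0) (lt_le_trans lt).
have r0 : 0 < r by apply: lt_trans Er.
have [K HK] := HE _ Er.
(* [d] exceeds [|K| * r ^+ 2], which makes the final estimate [p <= (|K| * r ^+ 2 / d) * p]
   impossible for [p > 0]. *)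
pose d := 1 + `|K| * r ^+ 2; have d0 : 0 < d.
  by apply: lt_le_trans ltr01 _; rewrite lerDl mulr_ge0 ?sqr_ge0.
have [g [Hg g0 Sg]] := Hr (r / d) (divr_gt0 r0 d0).
have lg := Hl2 _ Hg; have lSg := Hl2 _ (HS _ Hg); have lSSg := Hl2 _ (HS _ (HS _ Hg)).
have := HK _ Hg; rewrite l2sqnorm_lin //.
have -> : l2inner g (S (S g)) = (l2sqnorm (S g))%:C%C.
  by rewrite -Ssym ?l2innerff //; exact: HS.
have -> : complex.Re ((- r)%:C%C * (l2sqnorm (S g))%:C%C) = - r * l2sqnorm (S g).
  by rewrite ReM /= mul0r subr0.
have -> : normc (- r)%:C%C ^+ 2 = r ^+ 2 by rewrite normc_sqr /= expr0n addr0 sqrrN.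
have := ler _ (HS _ Hg); set p := l2sqnorm g in g0 Sg *; set q := l2sqnorm (S g) in Sg *.
set s := l2sqnorm (S (S g)) => le1 le2.
(* The left side is the squared norm of [S (S g) - r g]; it is small by [s <= r * q] and the
   near-maximality of [g]. *)
have le3 : s + 2 * (- r * q) + r ^+ 2 * p <= r * (r / d * p).
  have le4 : r * ((r - r / d) * p) <= r * q by rewrite ler_pM2l // ltW.
  by move: le1 le4; set t := r / d; lra.
have X0 : 0 <= s + 2 * (- r * q) + r ^+ 2 * p.
  rewrite [leRHS](_ : _ = l2sqnorm (fun n => S (S g) n + (- r)%:C%C * g n)).
    by apply: l2sqnorm_ge0; apply: in_l2_lin.
  rewrite l2sqnorm_lin // -Ssym ?l2innerff //; last exact: HS.
  by rewrite ReM /= mul0r subr0 normc_sqr /= expr0n addr0 sqrrN.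
have : p <= `|K| * (r * (r / d * p)).
  apply: le_trans le2 _; apply: le_trans (ler_wpM2r X0 (ler_norm K)) _.
  exact: ler_wpM2l.
have -> : `|K| * (r * (r / d * p)) = (`|K| * r ^+ 2 / d) * p by ring.
rewrite -[leLHS]mul1r ler_pM2r // ler_pdivlMr // mul1r /d; lra.
Qed.

End CoordinatesAndBounds.
Arguments delta_in_l2 {R} i.

(** * Resolvents and eigenfunction expansions *)

(** A symmetric linear restriction of [tau] with all basis vectors in its domain. The coefficients
    are arbitrary because a boundary condition at the origin shifts the first diagonal entry. *)
Record jacobi_realization (R : realType) (al be : nat -> R) (T : graph R) : Prop :=
  JacobiRealization {
  jr_l2 : forall f k, T (f, k) -> in_l2 f /\ in_l2 k;
  jr_tau : forall f k, T (f, k) -> k = tau al be f;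
  jr_lin : forall c f k f' k', T (f, k) -> T (f', k') ->
    T (fun n => f n + c * f' n, fun n => k n + c * k' n);
  jr_sym : forall f k f' k', T (f, k) -> T (f', k') -> l2inner k f' = l2inner f k';
  jr_delta : forall i, T (delta R i, tau al be (delta R i)) }.

Section Realizations.
Variable R : realType.
Implicit Types (T : graph R) (al be : nat -> R) (f k : nat -> R[i]) (x : R).

Arguments normc : simpl never.

Lemma graph_ext T f k f' k' : T (f, k) -> f =1 f' -> k =1 k' -> T (f', k').
Proof. by move=> H /funext <- /funext <-. Qed.

Lemma resolvent_real T al be x : jacobi_realization al be T ->
  ~ op_spectrum T x%:C%C ->
  (exists S : (nat -> R[i]) -> nat -> R[i],
     forall k, in_l2 k -> T (S k, fun n => k n + x%:C%C * S k n)) /\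
  exists2 K, 0 <= K & forall f k, T (f, k) ->
     l2sqnorm f <= K * l2sqnorm (fun n => k n + (- x)%:C%C * f n).
Proof.
move=> jT /contrapT[Hex [C HC]]; split.
  have /choice[S HS] : forall k, exists f, in_l2 k -> T (f, fun n => k n + x%:C%C * f n).
    move=> k; have [lk|nk] := pselect (in_l2 k); last by exists k.
    by have [f [Tf _]] := Hex k lk; exists f.
  by exists S.
exists (C ^+ 2) => [|f k Tfk]; first exact: sqr_ge0.
have [lf lk] := jr_l2 jT Tfk.
have := HC _ _ Tfk; have -> : (fun n => k n - x%:C%C * f n) = (fun n => k n + (- x)%:C%C * f n).
  by apply/funext => n; rewrite rmorphN mulNr.
have l := in_l2_lin (- x)%:C%C lk lf.
rewrite -!l2norm_sqr // -exprMn => h.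
by rewrite ler_sqr ?nnegrE ?sqrtr_ge0 // (le_trans _ h) ?sqrtr_ge0.
Qed.

Lemma resolvent_unique T al be x K f k f' : jacobi_realization al be T ->
  (forall f k, T (f, k) -> l2sqnorm f <= K * l2sqnorm (fun n => k n + (- x)%:C%C * f n)) ->
  T (f, fun n => k n + x%:C%C * f n) -> T (f', fun n => k n + x%:C%C * f' n) -> f = f'.
Proof.
move=> jT HK Tf Tf'; have Td := jr_lin jT (-1) Tf Tf'.
have [ld _] := jr_l2 jT Td.
have d0 : (fun n => f n + -1 * f' n) = fun=> 0.
  apply: l2sqnorm_eq0 => //; apply: le_trans (HK _ _ Td) _.
  rewrite (_ : (fun n => _ + _) = fun n => 0 * (fun n => f n + -1 * f' n) n).
    by rewrite l2sqnormZ // normc_sqr /= expr0n addr0 mul0r mulr0.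
  by apply/funext => n; rewrite rmorphN; ring.
apply/funext => n; have /(congr1 (fun h => h n)) /= := d0.
by rewrite mulN1r => /eqP; rewrite subr_eq0 => /eqP.
Qed.

Lemma real_resolvent_set T al be x K : jacobi_realization al be T ->
  (forall k, in_l2 k -> exists f, T (f, fun n => k n + x%:C%C * f n)) ->
  0 <= K -> (forall f k, T (f, k) ->
     l2sqnorm f <= K * l2sqnorm (fun n => k n + (- x)%:C%C * f n)) ->
  ~ op_spectrum T x%:C%C.
Proof.
move=> jT Hex K0 HK; apply; split.
  move=> k lk; have [f Tf] := Hex k lk; exists f; split=> // f' Tf'.
  exact: resolvent_unique jT HK Tf Tf'.
exists (Num.sqrt K) => f k Tfk; have [lf lk] := jr_l2 jT Tfk.
rewrite /l2norm -sqrtrM // ler_wsqrtr //; apply: le_trans (HK _ _ Tfk) _.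
rewrite le_eqVlt; apply/orP; left; apply/eqP; congr (_ * l2sqnorm _).
by apply/funext => n; rewrite rmorphN mulNr.
Qed.

End Realizations.

(** * Rank-one perturbation at the origin *)

Section RankOnePerturbation.
Variables (R : realType) (al be al2 be2 : nat -> R) (T1 T2 : graph R) (c : R).
Hypothesis jT1 : jacobi_realization al be T1.
Hypothesis jT2 : jacobi_realization al2 be2 T2.
Hypothesis T12 : forall f k,
  T2 (f, k) <-> T1 (f, fun n => k n - c%:C%C * f 0%N * delta R 0 n).

Arguments normc : simpl never.

(** Krein's formula. [T2] adds [c * f 0] times the first basis vector to [T1 f], so with [S] the
    resolvent of [T1] the equation [(T2 - x) f = k] becomes [f = S k - c * f 0 * w]; its first entry
    gives [f 0 = S k 0 / (1 + c * w 0)]. *)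
Lemma rank_one_resolvent (x : R) (w : nat -> R[i]) : ~ op_spectrum T1 x%:C%C ->
  T1 (w, fun n => delta R 0 n + x%:C%C * w n) -> 1 + c%:C%C * w 0%N != 0 ->
  ~ op_spectrum T2 x%:C%C.
Proof.
move=> xT1 T1w; set q := 1 + _ => q0.
have [[S HS] [K K0 HK]] := resolvent_real jT1 xT1.
have [lw _] := jr_l2 jT1 T1w.
apply: (real_resolvent_set
    (K := 2 * K + 2 * normc (- c%:C%C / q) ^+ 2 * K * l2sqnorm w) jT2).
- move=> k lk; have Tk := HS _ lk.
  exists (fun n => S k n + (- c%:C%C * S k 0%N / q) * w n); apply/T12.
  apply: (graph_ext (jr_lin jT1 (- c%:C%C * S k 0%N / q) Tk T1w)) => // n.
  have -> : S k 0%N + - c%:C%C * S k 0%N / q * w 0%N = S k 0%N / q.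
    by move: q0; rewrite /q => h; field.
  by ring.
- apply: addr_ge0; first exact: mulr_ge0.
  by apply: mulr_ge0 (l2sqnorm_ge0 lw); apply: mulr_ge0 K0; apply: mulr_ge0 (sqr_ge0 _).
move=> f k Tfk; have [lf lk] := jr_l2 jT2 Tfk.
have Tfk1 := (T12 _ _).1 Tfk.
(* For the norm bound, [f1 = f + c * f 0 * w] satisfies [(T1 - x) f1 = (T2 - x) f], and [f] is
   recovered from [f1] because [f1 0 = f 0 * q]. *)
have Tf1 := jr_lin jT1 (c%:C%C * f 0%N) Tfk1 T1w.
set y := fun n => k n + _; have ly : in_l2 y by apply: in_l2_lin.
have /= Hf1 := HK _ _ Tf1; set f1 := fun n => f n + c%:C%C * f 0%N * w n in Hf1.
have lf1 : in_l2 f1 by apply: in_l2_lin.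
have {}Hf1 : l2sqnorm f1 <= K * l2sqnorm y.
  apply: le_trans Hf1 _; rewrite le_eqVlt; apply/orP; left; apply/eqP.
  congr (_ * l2sqnorm _); apply/funext => n; rewrite /y /f1 rmorphN; ring.
have f1E : f1 0%N = f 0%N * q by rewrite /f1 /q; ring.
have fE : f = fun n => f1 n + (- c%:C%C / q * f1 0%N) * w n.
  apply/funext => n; rewrite f1E /f1; field; exact: q0.
rewrite {1}fE; apply: le_trans (l2sqnorm_lin_le _ lf1 lw) _.
rewrite normcM exprMn [leRHS]mulrDl lerD //; first by rewrite -mulrA ler_wpM2l.
have h := le_trans (normc_le_l2sqnorm 0 lf1) Hf1.
rewrite [leRHS](_ : _ = 2 * (normc (- c%:C%C / q) ^+ 2 * (K * l2sqnorm y)) * l2sqnorm w);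
  last by ring.
by rewrite ler_wpM2r ?l2sqnorm_ge0 // ler_wpM2l // ler_wpM2l ?sqr_ge0.
Qed.

End RankOnePerturbation.

(** The orthonormal polynomial of degree [n] at [x]. The recurrence is [tau u = x u] solved forward
    from [u 0 = 1], so these are the entries of the normalized eigenvector. *)
Fixpoint orthopoly (R : realType) (al be : nat -> R) (x : R) (n : nat) : R :=
  match n with
  | 0%N => 1
  | m.+1 =>
    match m with
    | 0%N => (x - al 0%N) / be 0%N
    | l.+1 => ((x - al m) * orthopoly al be x m - be l * orthopoly al be x l) / be m
    end
  end.

Section Orthopoly.
Variables (R : realType) (al be : nat -> R).
Hypothesis be_gt0 : forall n, 0 < be n.

Lemma orthopoly_rec x n : x * orthopoly al be x n =
  (if n is m.+1 then be m * orthopoly al be x m else 0) + al n * orthopoly al be x n +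
  be n * orthopoly al be x n.+1.
Proof.
have bn m : be m != 0 by rewrite gt_eqF.
case: n => [|n]; first by rewrite /=; field; exact: bn.
have -> : orthopoly al be x n.+2 = ((x - al n.+1) * orthopoly al be x n.+1 -
  be n * orthopoly al be x n) / be n.+1 by [].
by field; exact: bn.
Qed.

Lemma eigenvector_orthopoly x (u : nat -> R[i]) :
  (fun n => x%:C%C * u n) = tau al be u -> u 0%N = 1 ->
  u = fun n => (orthopoly al be x n)%:C%C.
Proof.
move=> tu u0; apply/funext => n.
have bn m : (be m)%:C%C != 0 :> R[i] by rewrite (inj_eq (@complexI _) _ 0) gt_eqF.
suff [] : u n = (orthopoly al be x n)%:C%C /\ u n.+1 = (orthopoly al be x n.+1)%:C%C by [].
elim: n => [|n [IH1 IH2]].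
  split=> //; have /(congr1 (fun h => h 0%N)) := tu; rewrite /tau u0 add0r => e.
  apply: (mulfI (bn 0%N)); have := orthopoly_rec x 0.
  move=> /(congr1 (real_complex R)); rewrite add0r rmorphD !rmorphM rmorph1 e => /addrI.
  exact.
split=> //; have /(congr1 (fun h => h n.+1)) := tu; rewrite /tau IH1 IH2 => e.
apply: (mulfI (bn n.+1)); have := orthopoly_rec x n.+1.
move=> /(congr1 (real_complex R)); rewrite !rmorphD !rmorphM /= e => /addrI.
exact.
Qed.

End Orthopoly.

(** * Completeness of the eigenvectors *)

Section EigenfunctionExpansion.
Variables (R : realType) (al be al2 be2 : nat -> R) (T1 T2 : graph R) (c : R).
Hypothesis jT1 : jacobi_realization al be T1.
Hypothesis jT2 : jacobi_realization al2 be2 T2.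
Hypothesis T12 : forall f k,
  T2 (f, k) <-> T1 (f, fun n => k n - c%:C%C * f 0%N * delta R 0 n).
Variables (Mj : pred nat) (l gam : nat -> R).
Let u (j : nat) : nat -> R[i] := fun n => (orthopoly al be (l j) n)%:C%C.
Hypothesis spec1 : forall x : R, op_spectrum T1 x%:C%C -> exists2 j, Mj j & x = l j.
Hypothesis spec2 : forall j, Mj j -> ~ op_spectrum T2 (l j)%:C%C.
Hypothesis eig : forall j, Mj j -> T1 (u j, fun n => (l j)%:C%C * u j n).
Hypothesis gamE : forall j, Mj j -> gam j = (l2sqnorm (u j))^-1.
Hypothesis gam_out : forall j, ~~ Mj j -> gam j = 0.
Hypothesis inj : forall i j, Mj i -> Mj j -> i != j -> l i != l j.
Hypothesis escape : forall C : R, exists N, forall j, (N <= j)%N -> Mj j -> C < `|l j|.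

Arguments normc : simpl never.

Lemma eig_l2 j : Mj j -> in_l2 (u j).
Proof. by move=> /eig/(jr_l2 jT1)[]. Qed.

Lemma eig_sqnorm_gt0 j : Mj j -> 0 < l2sqnorm (u j).
Proof.
move=> Mj_; apply: lt_le_trans (normc_le_l2sqnorm 0 (eig_l2 Mj_)).
by rewrite /u normc_sqr /= expr0n addr0 expr1n ltr01.
Qed.

Lemma gam_gt0 j : Mj j -> 0 < gam j.
Proof. by move=> Mj_; rewrite gamE // invr_gt0 eig_sqnorm_gt0. Qed.

Lemma eig_inner f k j : T1 (f, k) -> Mj j -> l2inner k (u j) = (l j)%:C%C * l2inner f (u j).
Proof.
move=> Tf Mj_; rewrite (jr_sym jT1 Tf (eig Mj_)).
have [lf _] := jr_l2 jT1 Tf; have lu := eig_l2 Mj_.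
by rewrite l2innerZr // conjc_real.
Qed.

Lemma eig_orthogonal i j : Mj i -> Mj j -> i != j -> l2inner (u i) (u j) = 0.
Proof.
move=> Mi Mj_ ij; have := eig_inner (eig Mi) Mj_.
have lu := eig_l2 Mi; have lv := eig_l2 Mj_.
rewrite l2innerZl // => /eqP; rewrite -subr_eq0.
rewrite (_ : _ - _ = ((l i)%:C%C - (l j)%:C%C) * l2inner (u i) (u j)); last by ring.
rewrite mulf_eq0 => /orP[|/eqP //]; rewrite -rmorphB /= (inj_eq (@complexI _) _ 0) subr_eq0.
by rewrite (negPf (inj Mi Mj_ ij)).
Qed.

Definition orthogonal_upto (N : nat) : set (nat -> R[i]) :=
  [set f | in_l2 f /\ forall j, (j < N)%N -> Mj j -> l2inner f (u j) = 0].

(* At an eigenvalue l_j the bound comes from T2, since both operators agree on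
   f - f(1) u_j, whose first entry vanishes. *)
Lemma bounded_below_upto N (x : R) : (forall j, (N <= j)%N -> Mj j -> x != l j) ->
  exists2 K, 0 <= K & forall f k, T1 (f, k) -> orthogonal_upto N f ->
    l2sqnorm f <= K * l2sqnorm (fun n => k n + (- x)%:C%C * f n).
Proof.
move=> xN; have [/spec1[j Mj_ xj]|nx] := pselect (op_spectrum T1 x%:C%C); last first.
  by have [_ [K K0 HK]] := resolvent_real jT1 nx; exists K => // f k Tf _; apply: HK.
have jN : (j < N)%N by rewrite ltnNge; apply: contraL (eqxx x) => /xN; rewrite {3}xj; apply.
rewrite {}xj; have [_ [K K0 HK]] := resolvent_real jT2 (spec2 Mj_).
exists K => // f k Tf [lf /(_ _ jN Mj_) fu].
have lu := eig_l2 Mj_.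
have Tg := jr_lin jT1 (- f 0%N) Tf (eig Mj_).
have T2g : T2 (fun n => f n + - f 0%N * u j n, fun n => k n + - f 0%N * ((l j)%:C%C * u j n)).
  apply/T12; apply: (graph_ext Tg) => // n.
  by rewrite /u /= mulr1 subrr mulr0 mul0r subr0.
(* [T1 - l j] annihilates [u j], so the right side is unchanged; [u j] is orthogonal to [f], so
   subtracting a multiple of it cannot lower the norm on the left. *)
have := HK _ _ T2g; rewrite (_ : (fun n => _ + _ + _) = fun n => k n + (- l j)%:C%C * f n).
  apply: le_trans; rewrite l2sqnorm_lin // (l2inner_conj lf lu) fu conjc0E mulr0 mulr0 addr0.
  by rewrite lerDl mulr_ge0 ?sqr_ge0 ?l2sqnorm_ge0.
by apply/funext => n; rewrite rmorphN; ring.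
Qed.

Lemma orthogonal_upto_lin N f g z : orthogonal_upto N f -> orthogonal_upto N g ->
  orthogonal_upto N (fun n => f n + z * g n).
Proof.
move=> [lf Hf] [lg Hg]; split=> [|j jN Mj_]; first exact: in_l2_lin.
have lu := eig_l2 Mj_.
by rewrite l2inner_linl // Hf // Hg // mulr0 addr0.
Qed.

Lemma resolvent_orthogonal N (x : R) f k : ~ op_spectrum T1 x%:C%C ->
  T1 (f, fun n => k n + x%:C%C * f n) -> orthogonal_upto N k -> orthogonal_upto N f.
Proof.
move=> nx Tf [lk Hk]; have [lf _] := jr_l2 jT1 Tf; split=> // j jN Mj_.
have lu := eig_l2 Mj_.
have := eig_inner Tf Mj_; rewrite l2inner_linl // Hk // add0r => /eqP.
rewrite -subr_eq0 -mulrBl mulf_eq0 => /orP[|/eqP //].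
rewrite -rmorphB /= (inj_eq (@complexI _) _ 0) subr_eq0 => /eqP xl.
(* If [x = l j], then [u j] and the zero vector, in the form [u j - u j], both solve
   [(T1 - x) f = 0], against uniqueness. *)
case: nx; move: (eig Mj_); rewrite -xl => Tu [Hex _].
have l0 := @in_l2_0 R; have [f0 [_ f0u]] := Hex _ l0.
have e1 : f0 = u j.
  by apply: f0u; apply: (graph_ext Tu) => // n; rewrite add0r.
have T0 := jr_lin jT1 (-1) Tu Tu.
have e2 : f0 = fun n => u j n + -1 * u j n.
  by apply: f0u; apply: (graph_ext T0) => // n; rewrite add0r; ring.
have := congr1 (fun h => h 0%N) (etrans (esym e1) e2).
by rewrite /u /= => /eqP; rewrite mulN1r subrr oner_eq0.
Qed.

(** [symmetric_bound] applied to the resolvent [S] at [x0] on the orthogonal complement of the first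
    eigenvectors. For [r > E] and [rho] the root of [r], [S^2 - r] factors into [S - rho] and
    [S + rho]; each is bounded below since [x0 + 1 / rho] and [x0 - 1 / rho] are closer to [x0] than
    any remaining pole. *)
Lemma resolvent_small_upto (x0 : R) : ~ op_spectrum T1 x0%:C%C -> forall E : R, 0 < E ->
  exists N, forall f k, T1 (f, fun n => k n + x0%:C%C * f n) -> orthogonal_upto N k ->
    l2sqnorm f <= E * l2sqnorm k.
Proof.
move=> nx E E0; have [[S HS] [B B0 HB]] := resolvent_real jT1 nx.
have [N HN] := escape ((Num.sqrt E)^-1 + `|x0|); exists N => f k Tf Hk.
have {}HN j : (N <= j)%N -> Mj j -> (Num.sqrt E)^-1 < `|l j - x0|.
  by move=> /HN/[apply] h; have := lerB_dist (l j) x0; lra.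
have uniq := resolvent_unique jT1 HB.
have -> : f = S k by apply: uniq Tf (HS _ Hk.1).
move: k {f Tf} Hk; apply: (@symmetric_bound _ _ S B E) => //.
- by move=> f [].
- by move=> f Hf; apply: resolvent_orthogonal (HS _ Hf.1) Hf.
- move=> f g [lf _] [lg _]; have Tf := HS _ lf; have Tg := HS _ lg.
  have [lSf _] := jr_l2 jT1 Tf; have [lSg _] := jr_l2 jT1 Tg.
  have := jr_sym jT1 Tf Tg; rewrite l2inner_linl // l2inner_linr // conjc_real.
  by move=> /addIr.
- move=> f [lf _]; have := HB _ _ (HS _ lf); congr (_ <= _ * l2sqnorm _).
  by apply/funext => n; rewrite rmorphN; ring.
move=> r Er; have r0 : 0 < r by apply: lt_trans Er.
pose rho := Num.sqrt r; have rho0 : 0 < rho by rewrite sqrtr_gt0.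
have rhoE : rho ^+ 2 = r by rewrite sqr_sqrtr // ltW.
(* With [h = S f - s f], the operator [T1 - x0 - 1 / s] maps [S f] to [- h / s]. So [h] controls
   [S f], and then [f] through [s f = S f - h]. *)
have side (s : R) : s ^+ 2 = r -> exists2 K, 0 <= K & forall f, orthogonal_upto N f ->
    l2sqnorm f <= K * l2sqnorm (fun n => S f n + (- s)%:C%C * f n).
  move=> sr; have s0 : s != 0 by rewrite -sqrf_eq0 sr gt_eqF.
  have xs j : (N <= j)%N -> Mj j -> x0 + s^-1 != l j.
    move=> jN Mj_; apply: contraTneq (HN _ jN Mj_) => <-.
    rewrite addrAC subrr add0r normfV -leNgt lef_pV2 ?posrE ?normr_gt0 ?sqrtr_gt0 //.
    by rewrite -sqrtr_sqr sr ler_wsqrtr // ltW.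
  have [K K0 HK] := bounded_below_upto xs.
  exists ((2 + 2 * K * s ^- 2) / r) => [|f Hf].
    apply: divr_ge0 (ltW r0); apply: addr_ge0 => //.
    by apply: mulr_ge0; [exact: mulr_ge0|rewrite invr_ge0 sqr_ge0].
  have Hf1 := Hf.1; have Tf := HS _ Hf1; have [lSf _] := jr_l2 jT1 Tf.
  set h := fun n => S f n + _; have lh : in_l2 h by apply: in_l2_lin.
  have := HK _ _ Tf (resolvent_orthogonal nx Tf Hf).
  rewrite (_ : (fun n => _ + _ + _) = fun n => (- s^-1)%:C%C * h n); last first.
    have sC : s%:C%C != 0 :> R[i] by rewrite (inj_eq (@complexI _) _ 0).
    by apply/funext => n; rewrite /h !(rmorphN, rmorphD, fmorphV) /=; field.
  rewrite l2sqnormZ // normc_sqr /= expr0n addr0 sqrrN exprVn => le1.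
  have := l2sqnorm_lin_le (-1) lSf lh.
  rewrite (_ : (fun n => _) = fun n => s%:C%C * f n); last first.
    by apply/funext => n; rewrite /h rmorphN; ring.
  rewrite l2sqnormZ // !normc_sqr /= oppr0 expr0n !addr0 sqrrN expr1n mulr1 sr => le2.
  rewrite mulrAC ler_pdivlMr // [leLHS]mulrC; apply: le_trans le2 _.
  by move: le1; rewrite sr; set t := r^-1; lra.
have [K1 K10 HK1] := side rho rhoE.
have [K2 K20 HK2] := side (- rho) (etrans (sqrrN _) rhoE).
exists (K1 * K2) => f Hf; have Hf1 := Hf.1; have Tf := HS _ Hf1.
apply: le_trans (HK1 _ Hf) _; rewrite -mulrA ler_wpM2l //.
set g := fun n => S f n + _.
have HSf := resolvent_orthogonal nx Tf Hf.
have Hg : orthogonal_upto N g by apply: orthogonal_upto_lin.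
have := HK2 _ Hg; congr (_ <= _ * l2sqnorm _).
have -> : S g = fun n => S (S f) n + (- rho)%:C%C * S f n.
  apply: uniq (HS _ Hg.1) _.
  apply: (graph_ext (jr_lin jT1 (- rho)%:C%C (HS _ HSf.1) Tf)) => // n.
  by rewrite /g; ring.
by apply/funext => n; rewrite /g -rhoE !(rmorphN, rmorphXn) /=; ring.
Qed.

(** As [gam j] is the inverse squared norm of [u j], each step subtracts the orthogonal projection
    onto [u j]; off [Mj] the weight 0 leaves the vector unchanged. *)
Fixpoint eig_residual (f : nat -> R[i]) (N : nat) : nat -> R[i] :=
  if N is j.+1 then
    fun n => eig_residual f j n + (- ((gam j)%:C%C * l2inner f (u j))) * u j n
  else f.

Lemma eig_residual_out f j : ~~ Mj j -> eig_residual f j.+1 = eig_residual f j.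
Proof.
by move=> nMj; apply/funext => n /=; rewrite gam_out // rmorph0 mul0r oppr0 mul0r addr0.
Qed.

Lemma eig_residual_l2 f N : in_l2 f -> in_l2 (eig_residual f N).
Proof.
move=> lf; elim: N => // j IH; have [Mj_|nMj] := boolP (Mj j).
  exact: in_l2_lin IH (eig_l2 Mj_).
by rewrite eig_residual_out.
Qed.

Local Arguments eig_residual_l2 {f} N _.

Lemma eig_residual_inner f N i : in_l2 f -> Mj i ->
  l2inner (eig_residual f N) (u i) = if (i < N)%N then 0 else l2inner f (u i).
Proof.
move=> lf Mi; elim: N => // j IH; have [Mj_|nMj] := boolP (Mj j); last first.
  rewrite eig_residual_out // IH ltnS [in RHS]leq_eqVlt; case: eqP => // ij.
  by rewrite -ij Mi in nMj.
have lr := eig_residual_l2 j lf; have lu := eig_l2 Mj_; have lv := eig_l2 Mi.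
rewrite /= l2inner_linl // IH ltnS; have [->{i Mi IH lv}|ij] := eqVneq i j.
  have e : (gam j)%:C%C * (l2sqnorm (u j))%:C%C = 1.
    by rewrite -rmorphM /= gamE // mulVf ?gt_eqF ?eig_sqnorm_gt0.
  by rewrite ltnn leqnn l2innerff // mulNr mulrAC e mul1r subrr.
rewrite eig_orthogonal // 1?eq_sym // mulr0 addr0.
by rewrite [in RHS]leq_eqVlt (negPf ij).
Qed.

Lemma eig_residual_orthogonal f N : in_l2 f -> orthogonal_upto N (eig_residual f N).
Proof.
move=> lf; split=> [|j jN Mj_]; first exact: eig_residual_l2.
by rewrite eig_residual_inner // jN.
Qed.

(** Bessel's inequality: step [j] lowers the squared norm by [gam j] times the squared modulus of
    the coefficient. *)
Lemma eig_residual_sqnorm f N : in_l2 f -> l2sqnorm (eig_residual f N) <= l2sqnorm f.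
Proof.
move=> lf; elim: N => // j; apply: le_trans; have [Mj_|nMj] := boolP (Mj j); last first.
  by rewrite eig_residual_out.
have lr := eig_residual_l2 j lf; have lu := eig_l2 Mj_.
rewrite /= l2sqnorm_lin // (l2inner_conj lr lu) eig_residual_inner // ltnn.
have g0 := gam_gt0 Mj_; have s0 := eig_sqnorm_gt0 Mj_.
set z := l2inner f (u j); set s := l2sqnorm (u j) in s0 *; set r := l2sqnorm _.
have -> : complex.Re (- ((gam j)%:C%C * z) * z^*%C) = - (gam j * normc z ^+ 2).
  by rewrite normc_sqr; case: z => x y /=; ring.
have -> : normc (- ((gam j)%:C%C * z)) ^+ 2 * s = gam j * normc z ^+ 2.
  transitivity (gam j * (gam j * s) * normc z ^+ 2).
    by rewrite !normc_sqr; case: z => x y /=; ring.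
  by rewrite gamE // mulVf ?gt_eqF // mulr1.
by have : 0 <= gam j * normc z ^+ 2; [rewrite mulr_ge0 ?sqr_ge0 ?ltW|lra].
Qed.

(** The coefficients of [k] are those of [f] times [l j - x], so the resolvent commutes with
    removing eigenvector components. *)
Lemma eig_residual_graph (x : R) f k N : T1 (f, fun n => k n + x%:C%C * f n) -> in_l2 k ->
  T1 (eig_residual f N, fun n => eig_residual k N n + x%:C%C * eig_residual f N n).
Proof.
move=> Tf lk; have [lf _] := jr_l2 jT1 Tf.
elim: N => // j IH; have [Mj_|nMj] := boolP (Mj j); last by rewrite !eig_residual_out.
apply: (graph_ext (jr_lin jT1 _ IH (eig Mj_))) => // n /=.
have lu := eig_l2 Mj_.
have -> : l2inner k (u j) = ((l j)%:C%C - x%:C%C) * l2inner f (u j).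
  by have := eig_inner Tf Mj_; rewrite l2inner_linl // mulrBl => <-; rewrite addrK.
by ring.
Qed.

Lemma eig_residualE f N n : eig_residual f N n =
  f n - \sum_(0 <= j < N) (gam j * orthopoly al be (l j) n)%:C%C * l2inner f (u j).
Proof.
elim: N => [|N IH] /=; first by rewrite big_geq // subr0.
by rewrite IH big_nat_recr //= opprD addrA /u rmorphM /=; congr (_ + _); ring.
Qed.

(** The residual of [f] is the resolvent applied to the residual of [k], which is orthogonal to the
    first [N] eigenvectors; by [resolvent_small_upto] its norm, hence each entry, tends to 0. *)
Lemma eigenfunction_expansion (x : R) f k n : ~ op_spectrum T1 x%:C%C ->
  T1 (f, fun n => k n + x%:C%C * f n) -> in_l2 k ->
  sums (fun j => gam j * orthopoly al be (l j) n * complex.Re (l2inner f (u j)))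
    (complex.Re (f n)) /\
  sums (fun j => gam j * orthopoly al be (l j) n * complex.Im (l2inner f (u j)))
    (complex.Im (f n)).
Proof.
move=> nx Tf lk; have [lf _] := jr_l2 jT1 Tf.
have small (e : R) : 0 < e -> \forall N \near \oo, normc (eig_residual f N n) ^+ 2 <= e ^+ 2.
  (* The summand 1 keeps the divisor positive when [k = 0]. *)
  move=> e0; pose E := e ^+ 2 / (1 + l2sqnorm k).
  have k0 : 0 < 1 + l2sqnorm k by rewrite ltr_wpDr ?l2sqnorm_ge0.
  have [N0 HN0] := resolvent_small_upto nx (divr_gt0 (exprn_gt0 2 e0) k0).
  exists N0 => // N /= N0N.
  have [lr Hr] := eig_residual_orthogonal N lk.
  have Tr := eig_residual_graph N Tf lk.
  have /HN0 -/(_ _ Tr) le1 : orthogonal_upto N0 (eig_residual k N).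
    by split=> // j jN0 Mj_; apply: Hr => //; apply: leq_trans N0N.
  have [lrf _] := jr_l2 jT1 Tr.
  apply: le_trans (normc_le_l2sqnorm n lrf) _; apply: le_trans le1 _.
  rewrite -mulrA ler_piMr ?sqr_ge0 // mulrC ler_pdivrMr // mul1r.
  by apply: le_trans (eig_residual_sqnorm N lk) _; rewrite lerDr.
have ReS (v : nat -> R[i]) N : complex.Re (\sum_(0 <= j < N) v j) =
    \sum_(0 <= j < N) complex.Re (v j).
  by elim: N => [|N IH]; [rewrite !big_geq | rewrite !big_nat_recr //= ReD IH].
have ImS (v : nat -> R[i]) N : complex.Im (\sum_(0 <= j < N) v j) =
    \sum_(0 <= j < N) complex.Im (v j).
  by elim: N => [|N IH]; [rewrite !big_geq | rewrite !big_nat_recr //= ImD IH].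
split; apply/cvgrPdist_le => e e0; apply: filterS (small e e0) => N leN.
- rewrite -ler_sqr ?nnegrE ?(ltW e0) // real_normK ?num_real //.
  apply: le_trans leN.
  rewrite (_ : _ - _ = complex.Re (eig_residual f N n)); first by rewrite normc_sqr lerDl sqr_ge0.
  rewrite eig_residualE ReD; congr (_ + _); rewrite -[in RHS]sumrN ReS /series /= -sumrN.
  by apply: eq_bigr => j _; case: (l2inner f (u j)) => p q /=; ring.
- rewrite -ler_sqr ?nnegrE ?(ltW e0) // real_normK ?num_real //.
  apply: le_trans leN.
  rewrite (_ : _ - _ = complex.Im (eig_residual f N n)); first by rewrite normc_sqr lerDr sqr_ge0.
  rewrite eig_residualE ImD; congr (_ + _); rewrite -[in RHS]sumrN ImS /series /= -sumrN.
  by apply: eq_bigr => j _; case: (l2inner f (u j)) => p q /=; ring.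
Qed.

(** Entry [n] of the expansion of the basis vector [delta R i], whose coefficient against [u j] is
    entry [i] of [u j]. *)
Lemma orthopoly_orthonormal (x : R) i n : ~ op_spectrum T1 x%:C%C ->
  sums (fun j => gam j * (orthopoly al be (l j) i * orthopoly al be (l j) n)) ((n == i)%:R).
Proof.
move=> nx; have Td := jr_delta jT1 i.
have [ld lt] := jr_l2 jT1 Td.
have lk : in_l2 (fun n => tau al be (delta R i) n + (- x)%:C%C * delta R i n) by apply: in_l2_lin.
have Td' : T1 (delta R i, fun n => (tau al be (delta R i) n + (- x)%:C%C * delta R i n) +
    x%:C%C * delta R i n).
  by apply: (graph_ext Td) => // m; rewrite rmorphN; ring.
have [+ _] := eigenfunction_expansion n nx Td' lk.
rewrite (_ : complex.Re (delta R i n) = (n == i)%:R); last by rewrite /delta; case: eqP.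
apply: sums_ext => j; have [Mj_|nMj] := boolP (Mj j); last by rewrite gam_out // !mul0r.
by rewrite (l2inner_deltal _ (eig_l2 Mj_)) /=; ring.
Qed.

(** Since [u j 0 = 1], pairing the resolvent equation with [u j] gives [w] the coefficient
    [1 / (l j - x)]. *)
Lemma resolvent_delta_expansion (x : R) w n : ~ op_spectrum T1 x%:C%C ->
  T1 (w, fun n => delta R 0 n + x%:C%C * w n) ->
  sums (fun j => gam j / (l j - x) * orthopoly al be (l j) n) (complex.Re (w n)) /\
  complex.Im (w n) = 0.
Proof.
move=> nx Tw; have [lw _] := jr_l2 jT1 Tw; have ld := delta_in_l2 (R := R) 0.
have wu j : Mj j -> l2inner w (u j) = ((l j - x)^-1)%:C%C.
  move=> Mj_; have lu := eig_l2 Mj_.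
  have := eig_inner Tw Mj_; rewrite l2inner_linl // (l2inner_deltal _ lu).
  have -> : (u j 0%N)^*%C = 1 by exact: (conjc_real 1).
  set z := l2inner w (u j) => e.
  have {}e : (l j - x)%:C%C * z = 1 by rewrite rmorphB mulrBl /= -e addrK.
  have ne : (l j - x)%:C%C != 0 :> R[i].
    by apply: contra_eq_neq e => ->; rewrite mul0r eq_sym oner_eq0.
  by apply: (mulfI ne); rewrite e -rmorphM /= mulfV // -(inj_eq (@complexI R)).
have [a Him] := eigenfunction_expansion n nx Tw ld; split.
  apply: sums_ext a => j; have [Mj_|nMj] := boolP (Mj j); last by rewrite gam_out // !mul0r.
  by rewrite wu //= mulrAC.
apply: (sums_unique Him); rewrite -[X in sums _ X](mul0r (complex.Re (w n))).
apply: sums_ext (sumsZ 0 a) => j.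
have [Mj_|nMj] := boolP (Mj j); last by rewrite gam_out // !mul0r.
by rewrite wu //= mul0r mulr0.
Qed.

(** By [rank_one_resolvent], a point of the spectrum of [T2] that is regular for [T1] forces
    [1 + c * w 0 = 0]; the series is the expansion of [w 0]. *)
Lemma perturbation_zero (x : R) : ~ op_spectrum T1 x%:C%C -> op_spectrum T2 x%:C%C ->
  sums (fun j => gam j / (l j - x)) (- c^-1).
Proof.
move=> nx sx; have [[S HS] _] := resolvent_real jT1 nx.
have Tw := HS _ (delta_in_l2 (R := R) 0); set w := S _ in Tw.
have [w0 Im0] := resolvent_delta_expansion 0 nx Tw.
have [/eqP|ne] := eqVneq (1 + c%:C%C * w 0%N) 0; last first.
  by case: (rank_one_resolvent jT1 jT2 T12 nx Tw ne).
move=> /eqP /(congr1 (@complex.Re R)); rewrite ReD ReM /= Im0 mul0r subr0 => e.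
have c0 : c != 0 by apply: contra_eq_neq e => ->; rewrite mul0r addr0 oner_eq0.
have -> : - c^-1 = complex.Re (w 0%N).
  by apply: (mulfI c0); rewrite mulrN mulfV //; apply/eqP; rewrite eq_sym -addr_eq0 addrC e.
by apply: sums_ext w0 => j; rewrite mulr1.
Qed.

End EigenfunctionExpansion.

(** * Recovering the coefficients *)

Section OrthopolyUnique.
Variables (R : realType) (l gam : nat -> R).
Implicit Types (al be : nat -> R).

Lemma eq_orthopoly al be al' be' x n :
  (forall k, (k < n)%N -> al k = al' k) -> (forall k, (k < n)%N -> be k = be' k) ->
  forall k, (k <= n)%N -> orthopoly al be x k = orthopoly al' be' x k.
Proof.
move=> Hal Hbe k kn.
suff H i : ((i <= n)%N -> orthopoly al be x i = orthopoly al' be' x i) /\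
    ((i < n)%N -> orthopoly al be x i.+1 = orthopoly al' be' x i.+1) by apply: (H k).1.
elim: i => [|i [IH1 IH2]]; first by split=> //= n0; rewrite Hal ?Hbe.
split=> // ln; have ltin : (i < n)%N by apply: ltnW.
have E al1 be1 : orthopoly al1 be1 x i.+2 = ((x - al1 i.+1) * orthopoly al1 be1 x i.+1 -
  be1 i * orthopoly al1 be1 x i) / be1 i.+1 by [].
by rewrite !E IH1 ?IH2 ?Hal ?Hbe // ltnW.
Qed.

Definition orthonormal_for al be : Prop := forall i n,
  sums (fun j => gam j * (orthopoly al be (l j) i * orthopoly al be (l j) n)) (n == i)%:R.

(** Multiply the three-term recurrence by the polynomial of degree [n]; orthonormality leaves only
    the diagonal coefficient. *)
Lemma diagonal_moment al be n : (forall n, 0 < be n) -> orthonormal_for al be ->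
  sums (fun j => gam j * (l j * orthopoly al be (l j) n ^+ 2)) (al n).
Proof.
move=> be0 ON; pose p := orthopoly al be.
have S := sumsD (sumsZ (al n) (ON n n)) (sumsZ (be n) (ON n n.+1)).
have {S} : sums (fun j => gam j * ((al n * p (l j) n + be n * p (l j) n.+1) * p (l j) n)) (al n).
  have -> : al n = al n * (n == n)%:R + be n * (n.+1 == n)%:R.
    by rewrite eqxx mulr1 gtn_eqF // mulr0 addr0.
  by apply: sums_ext S => j; rewrite -/p eqxx !mulr1 gtn_eqF // mulr0 addr0; ring.
case: n => [|n] S.
  by apply: sums_ext S => j; rewrite expr2 [l j * _]mulrA (orthopoly_rec _ be0) add0r.
have := sumsD S (sumsZ (be n) (ON n.+1 n)); rewrite ltn_eqF // mulr0 addr0.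
apply: sums_ext => j; rewrite expr2 [l j * _]mulrA (orthopoly_rec _ be0) -/p; ring.
Qed.

(** By the recurrence the squared expression is [be n] times the polynomial of degree [n.+1], yet it
    is written through lower data only. *)
Lemma offdiagonal_moment al be n : (forall n, 0 < be n) -> orthonormal_for al be ->
  sums (fun j => gam j * ((l j - al n) * orthopoly al be (l j) n -
    (if n is m.+1 then be m * orthopoly al be (l j) m else 0)) ^+ 2) (be n ^+ 2).
Proof.
move=> be0 ON; have := sumsZ (be n ^+ 2) (ON n.+1 n.+1); rewrite eqxx mulr1.
apply: sums_ext => j; rewrite mulrBl (orthopoly_rec _ be0).
by case: n => [|n]; ring.
Qed.

(** Polynomials up to degree [n] involve only coefficients below [n]; inductively the moments give
    [al n], then [be n ^+ 2], whose positive root is [be n]. *)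
Lemma orthonormal_unique al be al' be' : (forall n, 0 < be n) -> (forall n, 0 < be' n) ->
  orthonormal_for al be -> orthonormal_for al' be' -> al =1 al' /\ be =1 be'.
Proof.
move=> be0 be0' ON ON'.
suff H n : (forall k, (k < n)%N -> al k = al' k) /\ (forall k, (k < n)%N -> be k = be' k).
  by split=> n; [apply: (H n.+1).1 | apply: (H n.+1).2].
elim: n => [//|n [IH1 IH2]].
have pE j : forall k, (k <= n)%N -> orthopoly al be (l j) k = orthopoly al' be' (l j) k.
  exact: eq_orthopoly.
have aln : al n = al' n.
  apply: (sums_unique (diagonal_moment (n := n) be0 ON)).
  by apply: sums_ext (diagonal_moment (n := n) be0' ON') => j; rewrite pE.
have ben : be n = be' n.
  have : be n ^+ 2 = be' n ^+ 2.
    apply: (sums_unique (offdiagonal_moment (n := n) be0 ON)).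
    apply: sums_ext (offdiagonal_moment (n := n) be0' ON') => j; rewrite aln pE //.
    by case: n pE IH2 {IH1 aln} => // n pE IH2; rewrite pE // IH2.
  by move=> /eqP; rewrite eqrXn2 ?ltW // => /eqP.
by split=> k; rewrite ltnS leq_eqVlt => /orP[/eqP ->|]; [|exact: IH1| |exact: IH2].
Qed.

End OrthopolyUnique.

(** * Self-adjoint Jacobi operators and conditions at the origin *)

Section JacobiOperators.
Variables (R : realType) (a b : nat -> R) (g : option R).

Arguments normc : simpl never.

Lemma tau_delta i : tau a b (delta R i) = fun n =>
  (if i is m.+1 then (b m)%:C%C * delta R m n else 0) + (a i)%:C%C * delta R i n +
  (b i)%:C%C * delta R i.+1 n.
Proof.
apply/funext => n; rewrite /tau /delta.
case: n => [|n]; case: i => [|i]; rewrite ?eqSS /=.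
- by ring.
- by case: i => [|i] /=; ring.
- by case: n => [|n] /=; ring.
have [->|n1] := eqVneq n i.
  by rewrite ltn_eqF // gtn_eqF //=; ring.
have [->|n2] := eqVneq n i.+1; first by rewrite !gtn_eqF //=; ring.
by have [<-|n3] := eqVneq n.+1 i; rewrite /=; ring.
Qed.

Lemma l2inner_tau_delta f i : in_l2 f -> l2inner f (tau a b (delta R i)) = tau a b f i.
Proof.
move=> lf; rewrite tau_delta; have ld m := delta_in_l2 (R := R) m.
have la : in_l2 (fun n => (a i)%:C%C * delta R i n) by apply: in_l2Z.
have lab := in_l2_lin (b i)%:C%C la (ld i.+1).
rewrite /tau; case: i ld la lab => [|i] ld la lab.
  rewrite (_ : (fun n => _) = fun n => (a 0%N)%:C%C * delta R 0 n + (b 0%N)%:C%C * delta R 1 n).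
    by rewrite l2inner_linr // l2innerZr // !conjc_real !l2inner_delta add0r.
  by apply/funext => n; rewrite add0r.
rewrite (_ : (fun n => _) = fun n => ((a i.+1)%:C%C * delta R i.+1 n +
    (b i.+1)%:C%C * delta R i.+2 n) + (b i)%:C%C * delta R i n); last first.
  by apply/funext => n; ring.
rewrite l2inner_linr // l2inner_linr // l2innerZr // !conjc_real !l2inner_delta; ring.
Qed.

(** With self-adjointness this puts the zero pair into [jacobi a b g], which in the limit circle
    case exhibits an angle [alpha] for [g]. *)
Lemma jacobi_adjoint_zero : op_adjoint (jacobi a b g) (fun=> 0, fun=> 0).
Proof.
split; try exact: in_l2_0.
move=> f k _; rewrite /l2inner; congr csum; apply/funext => n.
by apply: complex_eqP; rewrite ?ReM ?ImM /=; ring.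
Qed.

Lemma Jmin_sub_jacobi : selfadjoint (jacobi a b g) -> Jmin a b `<=` jacobi a b g.
Proof.
move=> sa [f k] [[N /= fN] /= kE].
have lf : in_l2 f by apply: (finsupp_in_l2 fN).
have lk : in_l2 k.
  apply: (@finsupp_in_l2 _ _ N.+1) => n Nn; rewrite kE /tau /= fN ?(ltnW Nn) // fN; last first.
    by rewrite (leq_trans (ltnW Nn)).
  by case: n Nn => [//|m] mN; rewrite fN // !mulr0 !addr0.
have := jacobi_adjoint_zero; rewrite sa /jacobi; case: ifPn => _.
  have cst0 h : l2norm ((fun=> h) j \- h) @[j --> \oo] --> (0 : R).
    rewrite (_ : (fun _ => _) = cst 0); first exact: cvg_cst.
    apply/funext => _ /=; rewrite /l2norm /l2sqnorm (_ : series _ = cst 0) ?lim_cst ?sqrtr0 //.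
    apply/funext => n; rewrite /series /=; apply: big1 => i _.
    by rewrite /= subrr normc_sqr /= expr0n addr0.
  move=> _; split=> //=; exists (fun=> f), (fun=> k); split=> //=; try exact: cst0.
  by move=> _; split; [exists N|].
move=> [_ [alpha [a1 a2 _]]]; split; first by split=> //=; rewrite -kE.
exists alpha; split=> //; apply: cvg_near_cst; exists N => // n /= Nn.
by rewrite /wronskian /= !fN ?(leqW Nn) // mulr0 mul0r subrr mulr0 (normc0 R).
Qed.

(** Everything is read off the adjoint: pairing with basis vectors shows that the operator acts as
    [tau], and the adjoint condition is linear. *)
Lemma jacobi_selfadjoint_realization :
  selfadjoint (jacobi a b g) -> jacobi_realization a b (jacobi a b g).
Proof.
move=> sa; have mem p : jacobi a b g p -> op_adjoint (jacobi a b g) p by rewrite sa.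
have l2 f k : jacobi a b g (f, k) -> in_l2 f /\ in_l2 k by move=> /mem[].
have jd i : jacobi a b g (delta R i, tau a b (delta R i)).
  apply: Jmin_sub_jacobi => //; split=> //=; exists i.+1 => n.
  by rewrite /delta; case: eqP => // ->; rewrite ltnn.
have sym f k f' k' : jacobi a b g (f, k) -> jacobi a b g (f', k') -> l2inner k f' = l2inner f k'.
  by move=> J /mem[_ _]; apply.
split=> //.
- move=> f k J; apply/funext => i; have [lf lk] := l2 _ _ J.
  by have := sym _ _ _ _ J (jd i); rewrite l2inner_delta l2inner_tau_delta.
move=> c f k f' k' J J'; have [lf lk] := l2 _ _ J; have [lf' lk'] := l2 _ _ J'.
rewrite -sa; split=> [||h m Jh]; try exact: in_l2_lin.
have [lh lm] := l2 _ _ Jh.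
by rewrite /= !l2inner_linr // (sym _ _ _ _ Jh J) (sym _ _ _ _ Jh J').
Qed.

Definition shifted_diagonal (h : R) (n : nat) : R := a n - h * (n == 0%N)%:R.

Lemma jacobi_bcP h f k : jacobi_bc a b h g (f, k) <->
  jacobi a b g (f, fun n => k n + h%:C%C * f 0%N * delta R 0 n).
Proof.
rewrite /jacobi_bc /= (_ : l2inner f (@e1 R) = f 0%N); last exact: (l2inner_delta f 0).
split=> [[k0 [J kE]]|J].
  by apply: (graph_ext J) => // n; rewrite kE subrK.
by exists (fun n => k n + h%:C%C * f 0%N * delta R 0 n); split=> // n; rewrite addrK.
Qed.

Lemma jacobi_bc_realization h : selfadjoint (jacobi a b g) ->
  jacobi_realization (shifted_diagonal h) b (jacobi_bc a b h g).
Proof.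
move=> /jacobi_selfadjoint_realization jJ; have ld := delta_in_l2 (R := R) 0.
have tauE f n : tau (shifted_diagonal h) b f n = tau a b f n - h%:C%C * f 0%N * delta R 0 n.
  rewrite /tau /shifted_diagonal /delta; case: n => [|n] /=; rewrite rmorphB rmorphM /=.
    by rewrite rmorph1; ring.
  by rewrite rmorph0; ring.
have l2 f k : jacobi_bc a b h g (f, k) -> in_l2 f /\ in_l2 k.
  move=> /jacobi_bcP J; have [lf lk] := jr_l2 jJ J; split=> //.
  rewrite (_ : k = fun n => (k n + h%:C%C * f 0%N * delta R 0 n) +
      (- (h%:C%C * f 0%N)) * delta R 0 n).
    exact: in_l2_lin.
  by apply/funext => n; ring.
split=> //.
- move=> f k /jacobi_bcP J; apply/funext => n; rewrite tauE.
  by have /(congr1 (fun u => u n)) <- := jr_tau jJ J; rewrite addrK.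
- move=> c f k f' k' /jacobi_bcP J /jacobi_bcP J'; apply/jacobi_bcP.
  by apply: (graph_ext (jr_lin jJ c J J')) => // n; ring.
- move=> f k f' k' J J'; have [lf lk] := l2 _ _ J; have [lf' lk'] := l2 _ _ J'.
  move/jacobi_bcP: J => J; move/jacobi_bcP: J' => J'.
  have := jr_sym jJ J J'; rewrite l2inner_linl // l2inner_linr // l2inner_delta.
  rewrite l2inner_deltal // conjcM conjc_real.
  by rewrite mulrAC [h%:C%C * (f' 0%N)^*%C * _]mulrAC => /addIr.
move=> i; apply/jacobi_bcP; apply: (graph_ext (jr_delta jJ i)) => // n.
by rewrite tauE subrK.
Qed.

End JacobiOperators.

Lemma jacobi_bc_rank_one (R : realType) (a b : nat -> R) (g : option R) (h1 h2 : R) f k :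
  jacobi_bc a b h2 g (f, k) <->
  jacobi_bc a b h1 g (f, fun n => k n - (h1 - h2)%:C%C * f 0%N * delta R 0 n).
Proof.
rewrite !jacobi_bcP; split=> J; apply: (graph_ext J) => // n; rewrite rmorphB; ring.
Qed.

(** * The enumeration of two spectra *)

Section Enumerations.
Variables (R : realType) (M : set int) (x y : int -> R).
Hypothesis enumM : interlacing_enumeration M x y.

Lemma enumeration_lt n : M n -> x n < y n. Proof. by case: enumM => H _; apply: H. Qed.

Lemma enumeration_up :
  ereal_sup [set (x n)%:E | n in M] = +oo%E \/ exists b, forall n, M n <-> n <= b.
Proof.
case: enumM => _ [_ [_ [H1 [H2 _]]]].
set s := ereal_sup _ in H1 H2 *.
have [s0|s0] := leP s 0%E; first by right; exists 0 => n; rewrite H2.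
have [soo|] := ltP s +oo%E; last by rewrite leye_eq => /eqP; left.
by have [|[b _ ->] _] := H1; [rewrite s0 soo | right; exists b].
Qed.

Lemma enumeration_down :
  ereal_inf [set (y n)%:E | n in M] = -oo%E \/ exists b, forall n, M n <-> b <= n.
Proof.
case: enumM => _ [_ [_ [_ [_ [H1 H2]]]]].
set s := ereal_inf _ in H1 H2 *.
have [s0|s0] := leP 0%E s; first by right; exists 0 => n; rewrite H1.
have [soo|] := ltP -oo%E s; last by rewrite leeNy_eq => /eqP; left.
by have [|[b _ ->] _] := H2; [rewrite s0 soo | right; exists b].
Qed.

Lemma enumeration_cases : M = setT \/ (exists b, forall n, M n <-> n <= b) \/
  (exists b, forall n, M n <-> b <= n).
Proof.
have [up|] := enumeration_up; last by right; left.
have [down|] := enumeration_down; last by right; right.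
left; case: enumM => _ [_ [H _]]; apply: (H _ up).1.
(* As [x n < y n], the infimum of [x] is at most that of [y]. *)
apply/eqP; rewrite -leeNy_eq -down; apply: le_ereal_inf_tmp => _ [n Mn <-].
apply: ge_ereal_inf; exists (x n)%:E; first by exists n.
by rewrite lee_fin ltW // enumeration_lt.
Qed.

Lemma enumeration_nonempty : exists n, M n.
Proof.
by have [->|[[b H]|[b H]]] := enumeration_cases; [exists 0|exists b; apply/H..].
Qed.

Lemma enumeration_convex n k i : M n -> M k -> n <= i -> i <= k -> M i.
Proof.
move=> Mn Mk ni ik; have [->//|[[b H]|[b H]]] := enumeration_cases.
  by apply/H; apply: le_trans ik _; apply/H.
by apply/H; apply: le_trans _ ni; apply/H.
Qed.

Lemma enumeration_interlace n k : M n -> M k -> n < k -> y n < x k.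
Proof.
move=> Mn Mk nk; have [m mE] : exists m : nat, k = n + m.+1%:Z.
  by exists (`|k - n|%N.-1); lia.
move: Mk; rewrite {}mE {k nk}; elim: m => [|m IH] Mk.
  by case: enumM => _ [H _]; apply: H.
have Mi : M (n + m.+1%:Z) by apply: enumeration_convex Mn Mk _ _; lia.
apply: lt_trans (IH Mi) _; apply: lt_trans (enumeration_lt Mi) _.
have E : n + m.+2%:Z = n + m.+1%:Z + 1 by lia.
by rewrite E in Mk *; case: enumM => _ [H _]; apply: H.
Qed.

(** Upwards either [x] is unbounded or [M] ends, downwards the same holds for [y]; by interlacing
    one point beyond [C] pushes all later ones beyond it. *)
Lemma enumeration_escape (C : R) :
  exists B : nat, forall n, M n -> (B < `|n|)%N -> C < `|x n| /\ C < `|y n|.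
Proof.
have [b1 H1] : exists b, forall n, M n -> b < n -> C < x n.
  have [up|[b Hb]] := enumeration_up; last first.
    by exists b => n /Hb nb; rewrite ltNge nb.
  have : (C%:E < ereal_sup [set (x n)%:E | n in M])%E by rewrite up ltry.
  move=> /ereal_sup_gt[_ [b Mb <-]]; rewrite lte_fin => Cb; exists b => n Mn bn.
  apply: lt_trans Cb _; apply: lt_trans (enumeration_lt Mb) _.
  exact: enumeration_interlace.
have [b2 H2] : exists b, forall n, M n -> n < b -> y n < - C.
  have [down|[b Hb]] := enumeration_down; last first.
    by exists b => n /Hb nb; rewrite ltNge nb.
  have : (ereal_inf [set (y n)%:E | n in M] < (- C)%:E)%E by rewrite down ltNyr.
  move=> /ereal_inf_lt[_ [b Mb <-]]; rewrite lte_fin => Cb; exists b => n Mn bn.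
  apply: lt_trans Cb; apply: lt_trans (enumeration_lt Mb).
  exact: enumeration_interlace.
exists (`|b1| + `|b2|)%N => n Mn Bn; have xy := enumeration_lt Mn.
have [lt|lt] : b1 < n \/ n < b2 by lia.
  have Cx := H1 _ Mn lt; split; first exact: lt_le_trans (ler_norm _).
  by apply: lt_le_trans (ler_norm _); apply: lt_trans xy.
have Cy := H2 _ Mn lt; split; rewrite -normrN.
  by apply: lt_le_trans (ler_norm _); rewrite ltrNr; apply: lt_trans xy _.
by apply: lt_le_trans (ler_norm _); rewrite ltrNr.
Qed.

End Enumerations.

(* The integers are listed by natural numbers, so that sums over M become series. *)
Definition int_of_index (j : nat) : int := if odd j then Negz j./2 else Posz j./2.

Definition index_of_int (i : int) : nat :=
  match i with Posz n => n.*2 | Negz n => n.*2.+1 end.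

Lemma index_of_intK : cancel index_of_int int_of_index.
Proof. by case=> n; rewrite /int_of_index /= ?odd_double ?doubleK //= uphalf_double. Qed.

Lemma int_of_indexK : cancel int_of_index index_of_int.
Proof. by move=> j; rewrite /int_of_index -[RHS]odd_double_half; case: ifP. Qed.

Lemma int_of_index_escape (B j : nat) : (B.+1.*2 <= j)%N -> (B < `|int_of_index j|)%N.
Proof. by rewrite /int_of_index; case: ifP => _ /=; lia. Qed.

(** Stated with quotients, the conditions read the same whichever of [h1] and [h2] is larger, as
    [spectral_data] requires. *)
Lemma two_spectra_interlace (R : realType) (h1 h2 : R) M lam nu :
  h1 <> h2 -> two_spectra_enumeration h1 h2 M lam nu ->
  [/\ exists n, M n,
    forall n, M n -> 0 < (nu n - lam n) / (h1 - h2),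
    forall n k, M n -> M k -> n != k -> 0 < (lam n - lam k) / (lam n - nu k) &
    forall C, exists B : nat, forall n, M n -> (B < `|n|)%N -> C < `|lam n|].
Proof.
move=> h12; rewrite /two_spectra_enumeration; case: (ltP h2 h1) => [lt|le] en.
  split=> [|n Mn|n k Mn Mk nk|C]; first exact: enumeration_nonempty en.
  - by rewrite divr_gt0 // subr_gt0 // (enumeration_lt en).
  - have xy := enumeration_lt en; have [nk'|kn|e] := ltgtP n k; last by rewrite e eqxx in nk.
      have h := enumeration_interlace en Mn Mk nk'.
      by have := xy _ Mn; have := xy _ Mk => a b; rewrite -mulrNN -invrN divr_gt0 // oppr_gt0; lra.
    have h := enumeration_interlace en Mk Mn kn.
    by have := xy _ Mn; have := xy _ Mk => a b; rewrite divr_gt0 //; lra.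
  - by have [B HB] := enumeration_escape en C; exists B => n Mn /(HB _ Mn)[].
have lt : h1 < h2 by rewrite lt_neqAle le andbT; apply/eqP.
split=> [|n Mn|n k Mn Mk nk|C]; first exact: enumeration_nonempty en.
- by rewrite -mulrNN -invrN divr_gt0 // oppr_gt0 subr_lt0 // (enumeration_lt en).
- have xy := enumeration_lt en; have [nk'|kn|e] := ltgtP n k; last by rewrite e eqxx in nk.
    have h := enumeration_interlace en Mn Mk nk'.
    by have := xy _ Mn; have := xy _ Mk => a b; rewrite -mulrNN -invrN divr_gt0 // oppr_gt0; lra.
  have h := enumeration_interlace en Mk Mn kn.
  by have := xy _ Mn; have := xy _ Mk => a b; rewrite divr_gt0 //; lra.
- by have [B HB] := enumeration_escape en C; exists B => n Mn /(HB _ Mn)[].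
Qed.

Record two_spectra_setup (R : realType) (a b : nat -> R) (g : option R) (h1 h2 : R)
    (M : set int) (lam nu gam : int -> R) : Prop := TwoSpectraSetup {
  ts_b : forall n, 0 < b n;
  ts_sa : selfadjoint (jacobi a b g);
  ts_h : h1 <> h2;
  ts_spec1 : op_spectrum (jacobi_bc a b h1 g) = [set (lam n)%:C%C | n in M];
  ts_spec2 : op_spectrum (jacobi_bc a b h2 g) = [set (nu n)%:C%C | n in M];
  ts_enum : two_spectra_enumeration h1 h2 M lam nu;
  ts_norm : forall n, M n -> is_norming_constant (jacobi_bc a b h1 g) (lam n) (gam n) }.

(** * Spectral data of two boundary conditions at the origin *)

Section TwoSpectra.
Variables (R : realType) (a b : nat -> R) (g : option R) (h1 h2 : R).
Variables (M : set int) (lam nu gam : int -> R).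
Hypothesis ts : two_spectra_setup a b g h1 h2 M lam nu gam.

Arguments normc : simpl never.

Definition index_set : pred nat := fun j => `[< M (int_of_index j) >].
(** The value 0 off the index set turns series weighted by [index_seq gam] into sums over [M]. *)
Definition index_seq (s : int -> R) (j : nat) : R :=
  if index_set j then s (int_of_index j) else 0.

Local Notation al := (shifted_diagonal a h1).
Local Notation T1 := (jacobi_bc a b h1 g).
Local Notation T2 := (jacobi_bc a b h2 g).
Local Notation l := (index_seq lam).
Local Notation v := (index_seq nu).
Local Notation weight := (index_seq gam).
Local Notation u := (fun j n => (orthopoly al b (l j) n)%:C%C).

Lemma index_setP j : reflect (M (int_of_index j)) (index_set j).
Proof. exact: asboolP. Qed.

Lemma index_seqE s j : index_set j -> index_seq s j = s (int_of_index j).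
Proof. by rewrite /index_seq => ->. Qed.

Let jT1 : jacobi_realization al b T1 := jacobi_bc_realization h1 (ts_sa ts).
Let jT2 : jacobi_realization (shifted_diagonal a h2) b T2 := jacobi_bc_realization h2 (ts_sa ts).
Let T12 : forall f k, T2 (f, k) <->
  T1 (f, fun n => k n - (h1 - h2)%:C%C * f 0%N * delta R 0 n) := jacobi_bc_rank_one a b g h1 h2.

Lemma spectrum1_index (x : R) : op_spectrum T1 x%:C%C <-> exists2 j, index_set j & x = l j.
Proof.
rewrite (ts_spec1 ts); split=> [[n Mn] /complexI e|[j Mj ->]].
  have Mj : index_set (index_of_int n) by apply/index_setP; rewrite index_of_intK.
  by exists (index_of_int n); rewrite // index_seqE // index_of_intK.
by exists (int_of_index j); [apply/index_setP | rewrite index_seqE].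
Qed.

Lemma spectrum2_index (x : R) : op_spectrum T2 x%:C%C <-> exists2 j, index_set j & x = v j.
Proof.
rewrite (ts_spec2 ts); split=> [[n Mn] /complexI e|[j Mj ->]].
  have Mj : index_set (index_of_int n) by apply/index_setP; rewrite index_of_intK.
  by exists (index_of_int n); rewrite // index_seqE // index_of_intK.
by exists (int_of_index j); [apply/index_setP | rewrite index_seqE].
Qed.

Lemma index_neq i j : i != j -> int_of_index i != int_of_index j.
Proof. by rewrite (can_eq int_of_indexK). Qed.

Lemma index_sep i j : index_set i -> index_set j -> i != j -> 0 < (l i - l j) / (l i - v j).
Proof.
have [_ _ sep _] := two_spectra_interlace (ts_h ts) (ts_enum ts).
by move=> Mi Mj /index_neq; rewrite !index_seqE //; apply: sep; apply/index_setP.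
Qed.

Lemma index_sgn j : index_set j -> 0 < (v j - l j) / (h1 - h2).
Proof.
have [_ sgn _ _] := two_spectra_interlace (ts_h ts) (ts_enum ts).
by move=> Mj; rewrite !index_seqE //; apply: sgn; apply/index_setP.
Qed.

Lemma index_disjoint i j : index_set i -> index_set j -> l i != v j.
Proof.
move=> Mi Mj; have [->|ij] := eqVneq i j.
  by apply: contraTneq (index_sgn Mj) => ->; rewrite subrr mul0r ltxx.
by apply: contraTneq (index_sep Mi Mj ij) => ->; rewrite [_ - v j]subrr invr0 mulr0 ltxx.
Qed.

Lemma index_inj i j : index_set i -> index_set j -> i != j -> l i != l j.
Proof.
by move=> Mi Mj ij; apply: contraTneq (index_sep Mi Mj ij) => ->; rewrite subrr mul0r ltxx.
Qed.

Lemma index_escape (C : R) : exists N, forall j, (N <= j)%N -> index_set j -> C < `|l j|.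
Proof.
have [_ _ _ esc] := two_spectra_interlace (ts_h ts) (ts_enum ts).
have [B HB] := esc C; exists B.+1.*2 => j jN Mj; rewrite index_seqE //.
by apply: HB; [apply/index_setP | apply: int_of_index_escape].
Qed.

Lemma index_eigenvector j : index_set j ->
  T1 (u j, fun n => (l j)%:C%C * u j n) /\ weight j = (l2sqnorm (u j))^-1.
Proof.
move=> Mj; have [w [Tw w0 gE]] := ts_norm ts (elimT (index_setP j) Mj).
have wE := eigenvector_orthopoly (ts_b ts) (jr_tau jT1 Tw) w0.
by rewrite -(index_seqE lam Mj) in Tw wE; rewrite wE in Tw gE; split=> //; rewrite index_seqE.
Qed.

Let eig j (Mj : index_set j) := (index_eigenvector Mj).1.
Let weightE j (Mj : index_set j) := (index_eigenvector Mj).2.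

Lemma index_seq_out s j : ~~ index_set j -> index_seq s j = 0.
Proof. by rewrite /index_seq => /negbTE ->. Qed.

Lemma index_regular2 j : index_set j -> ~ op_spectrum T2 (l j)%:C%C.
Proof.
by move=> Mj /spectrum2_index[i Mi e]; have := index_disjoint Mj Mi; rewrite e eqxx.
Qed.

Lemma index_regular1 j : index_set j -> ~ op_spectrum T1 (v j)%:C%C.
Proof.
by move=> Mj /spectrum1_index[i Mi e]; have := index_disjoint Mi Mj; rewrite e eqxx.
Qed.

Let spec1 (x : R) := (spectrum1_index x).1.

Lemma index_point : exists j, index_set j.
Proof.
have [[n Mn] _ _ _] := two_spectra_interlace (ts_h ts) (ts_enum ts).
by exists (index_of_int n); apply/index_setP; rewrite index_of_intK.
Qed.

Lemma setup_orthonormal : orthonormal_for l weight al b.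
Proof.
(* The zero [v j] serves as a real regular point of [T1]. *)
move=> i n; have [j Mj] := index_point.
exact: (orthopoly_orthonormal jT1 jT2 T12 spec1 index_regular2 eig weightE (index_seq_out gam)
  index_inj index_escape (index_regular1 Mj)).
Qed.

Lemma setup_spectral_data : spectral_data index_set l v (h1 - h2) weight.
Proof.
split.
- by rewrite subr_eq0; apply/eqP; apply: ts_h ts.
- exact: index_sep.
- exact: index_sgn.
- exact: index_seq_out gam.
- move=> j; have [Mj|/index_seq_out -> //] := boolP (index_set j).
  exact: ltW (gam_gt0 jT1 eig weightE Mj).
- have := setup_orthonormal (i := 0) (n := 0); rewrite eqxx.
  by apply: sums_ext => j /=; rewrite !mulr1.
move=> k Mk; apply: (perturbation_zero jT1 jT2 T12 spec1 index_regular2 eig weightE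
  (index_seq_out gam) index_inj index_escape (index_regular1 Mk)).
by apply/spectrum2_index; exists k.
Qed.

(* At z = 0 the resolvent applied to the first basis vector, or the eigenvector,
   is determined by the spectral data and lies in the domain of J(g). *)
Lemma setup_zero_solution : exists f : nat -> R[i],
  [/\ exists k, jacobi a b g (f, k), forall n, tau a b f n.+1 = 0,
      f 0%N != 0 \/ f 1%N != 0 &
      (exists2 j, index_set j & l j = 0 /\ f = u j) \/
      (forall j, index_set j -> l j != 0) /\ forall n, complex.Im (f n) = 0 /\
        sums (fun j => weight j / l j * orthopoly al b (l j) n) (complex.Re (f n))].
Proof.
have tauS f n : tau al b f n.+1 = tau a b f n.+1.
  by rewrite /tau /shifted_diagonal mulr0 subr0.
have [[j Mj l0]|n0] := pselect (exists2 j, index_set j & 0 = l j).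
  exists (u j); have Tu := eig Mj; split.
  - by move/jacobi_bcP: Tu => J; eexists; exact: J.
  - by move=> n; rewrite -tauS -(jr_tau jT1 Tu) -l0 mul0r.
  - by left; rewrite oner_eq0.
  - by left; exists j.
have nx : ~ op_spectrum T1 (0 : R)%:C%C by move/spectrum1_index.
have [[S HS] _] := resolvent_real jT1 nx.
have Tw := HS _ (delta_in_l2 (R := R) 0); set w := S _ in Tw.
have tw n : tau al b w n = delta R 0 n by rewrite -(jr_tau jT1 Tw) mul0r addr0.
exists w; split.
- by move/jacobi_bcP: Tw => J; eexists; exact: J.
- by move=> n; rewrite -tauS tw.
(* If both entries vanished, the first row of [tau al b w = delta R 0] would read [0 = 1]. *)
- apply/orP; rewrite -negb_and; apply/negP => /andP[/eqP w0 /eqP w1].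
  have /eqP := tw 0%N; rewrite /tau w0 w1 !mulr0 !addr0 /delta eqxx.
  by rewrite eq_sym oner_eq0.
right; split=> [j Mj|n]; first by apply/eqP => e; apply: n0; exists j.
have [S1 S2] := resolvent_delta_expansion jT1 jT2 T12 spec1 index_regular2 eig weightE
  (index_seq_out gam) index_inj index_escape n nx Tw.
by split=> //; apply: sums_ext S1 => j; rewrite subr0.
Qed.

End TwoSpectra.

(** * The boundary condition at infinity *)

Lemma wronskian_const (R : realType) (a b : nat -> R) (f k : nat -> R[i]) :
  (forall n, tau a b f n.+1 = 0) -> (forall n, tau a b k n.+1 = 0) ->
  forall n, wronskian b f k n = wronskian b f k 0.
Proof.
move=> tf tk; elim=> // n <-; rewrite /wronskian.
have := tf n; have := tk n; rewrite /tau => e1 e2.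
apply/eqP; rewrite -subr_eq0; apply/eqP.
transitivity (f n.+1 * ((b n)%:C%C * k n + (a n.+1)%:C%C * k n.+1 + (b n.+1)%:C%C * k n.+2) -
  k n.+1 * ((b n)%:C%C * f n + (a n.+1)%:C%C * f n.+1 + (b n.+1)%:C%C * f n.+2)); first by ring.
by rewrite e1 e2 !mulr0 subrr.
Qed.

Lemma zero_solution_tau (R : realType) (a b : nat -> R) (b_gt0 : forall n, 0 < b n) p q n :
  tau a b (fun n => (zero_solution a b p q n)%:C%C) n.+1 = 0.
Proof.
have E : zero_solution a b p q n.+2 = - (b n * zero_solution a b p q n +
  a n.+1 * zero_solution a b p q n.+1) / b n.+1 by [].
rewrite /tau E; move: (zero_solution a b p q n) (zero_solution a b p q n.+1) => s t.
have bn : (b n.+1)%:C%C != 0 :> R[i] by rewrite (inj_eq (@complexI _) _ 0) gt_eqF.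
by rewrite !(rmorphM, rmorphN, rmorphD, fmorphV) /=; field.
Qed.

(** The Wronskian of [f] with a boundary solution is constant, so its limit 0 is its first value:
    [cos z * f 1 = sin z * f 0]. As the first two entries of [f] are not both 0, this determines the
    angle in [[0, pi)]. *)
Lemma boundary_condition_unique (R : realType) (a b : nat -> R) (b_gt0 : forall n, 0 < b n)
    (g g' : option R) (f k k' : nat -> R[i]) : ~ Defs.limit_point a b ->
  jacobi a b g (f, k) -> jacobi a b g' (f, k') -> (forall n, tau a b f n.+1 = 0) ->
  f 0%N != 0 \/ f 1%N != 0 -> g = g'.
Proof.
move=> nlp; rewrite /jacobi (asboolF nlp) => -[_ [s [s_itv -> Ws]]] [_ [t [t_itv -> Wt]]] tf f01.
have main z : normc (wronskian b (boundary_solution a b z) f n) @[n --> \oo] --> (0 : R) ->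
    (cos z)%:C%C * f 1%N = (sin z)%:C%C * f 0%N.
  have tz n : tau a b (boundary_solution a b z) n.+1 = 0.
    transitivity ((cos z)%:C%C * tau a b (fun n => (c0 a b n)%:C%C) n.+1 +
      (sin z)%:C%C * tau a b (fun n => (s0 a b n)%:C%C) n.+1).
      by rewrite /tau /boundary_solution !rmorphD !rmorphM /=; ring.
    by rewrite !zero_solution_tau // !mulr0 addr0.
  have W := wronskian_const tz tf.
  rewrite (_ : (fun n => _) = cst (normc (wronskian b (boundary_solution a b z) f 0))); last first.
    by apply/funext => n; rewrite W.
  move=> /(cvg_unique (@Rhausdorff R) (cvg_cst _)) /eq0_normc /eqP.
  rewrite /wronskian mulf_eq0 (inj_eq (@complexI _) _ 0) gt_eqF //= subr_eq0 => /eqP.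
  rewrite /boundary_solution /c0 /s0 /= !mulr1 !mulr0 addr0 add0r => ->.
  by rewrite mulrC.
have {Ws} es := main _ Ws; have {Wt} et := main _ Wt.
have sc0 : sin s * cos t = sin t * cos s.
  apply/eqP; rewrite -subr_eq0 -(inj_eq (@complexI R)) rmorphB !rmorphM /=.
  set d := _ - _; have d0 : d * f 0%N = 0.
    have -> : d * f 0%N = (cos t)%:C%C * ((sin s)%:C%C * f 0%N) -
      (cos s)%:C%C * ((sin t)%:C%C * f 0%N) by rewrite /d; ring.
    by rewrite -es -et; ring.
  have d1 : d * f 1%N = 0.
    have -> : d * f 1%N = (sin s)%:C%C * ((cos t)%:C%C * f 1%N) -
      (sin t)%:C%C * ((cos s)%:C%C * f 1%N) by rewrite /d; ring.
    by rewrite es et; ring.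
  case: f01 => [f0|f1].
    by move/eqP: d0; rewrite mulf_eq0 (negPf f0) orbF.
  by move/eqP: d1; rewrite mulf_eq0 (negPf f1) orbF.
congr cot_ext; move/andP: s_itv => [s_ge0 spi]; move/andP: t_itv => [t_ge0 tpi].
have sub (z z' : R) : 0 <= z -> z' < pi -> sin z' * cos z = sin z * cos z' -> z' <= z.
  move=> z0 z'pi e; rewrite leNgt; apply/negP => lt.
  have : 0 < sin (z' - z) by apply: sin_gt0_pi; apply/andP; split; lra.
  by rewrite sinB e [cos z' * _]mulrC subrr ltxx.
by apply/eqP; rewrite eq_le (sub t s) // (sub s t).
Qed.

(** * Uniqueness from mixed spectral data *)

Theorem theorem3p5 (R : realType) (a b a' b' : nat -> R) (g g' : option R)
  (h1 h2 h1' h2' : R) (M A : set int) (lam nu lam' nu' gam gam' : int -> R)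
  (b_gt0 : forall n, 0 < b n) (b'_gt0 : forall n, 0 < b' n)
  (selfadj : selfadjoint (jacobi a b g))
  (selfadj' : selfadjoint (jacobi a' b' g'))
  (discr : discrete_spectrum (jacobi a b g))
  (discr' : discrete_spectrum (jacobi a' b' g'))
  (h12 : h1 <> h2) (h12' : h1' <> h2')
  (spec1 : op_spectrum (jacobi_bc a b h1 g) = [set (lam n)%:C%C | n in M])
  (spec2 : op_spectrum (jacobi_bc a b h2 g) = [set (nu n)%:C%C | n in M])
  (spec1' : op_spectrum (jacobi_bc a' b' h1' g') = [set (lam' n)%:C%C | n in M])
  (spec2' : op_spectrum (jacobi_bc a' b' h2' g') = [set (nu' n)%:C%C | n in M])
  (enum : two_spectra_enumeration h1 h2 M lam nu)
  (enum' : two_spectra_enumeration h1' h2' M lam' nu')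
  (normg : forall n, M n ->
     is_norming_constant (jacobi_bc a b h1 g) (lam n) (gam n))
  (normg' : forall n, M n ->
     is_norming_constant (jacobi_bc a' b' h1' g') (lam' n) (gam' n))
  (subAM : A `<=` M)
  (eq_lam : forall n, M n -> lam n = lam' n)
  (eq_nu : forall n, (M `\` A) n -> nu n = nu' n)
  (eq_gam : forall n, A n -> gam n = gam' n)
  (eq_num : exists2 m, A m & nu m = nu' m) :
  (h1 = h1' ->
    [/\ forall n, a n = a' n, forall n, b n = b' n, h2 = h2' &
        limit_circle a b -> g = g']) /\
  (h2 = h2' ->
    [/\ forall n, a n = a' n, forall n, b n = b' n, h1 = h1' &
        limit_circle a b -> g = g']).
Proof.
have [m Am num] := eq_num.
have ts := TwoSpectraSetup b_gt0 selfadj h12 spec1 spec2 enum normg.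
have ts' := TwoSpectraSetup b'_gt0 selfadj' h12' spec1' spec2' enum' normg'.
have [ON ON'] := (setup_orthonormal ts, setup_orthonormal ts').
have [sd sd'] := (setup_spectral_data ts, setup_spectral_data ts').
have el : index_seq M lam' = index_seq M lam.
  apply/funext => j; rewrite /index_seq; case: ifP => // /index_setP Mj.
  by rewrite eq_lam.
have escape := index_escape ts.
rewrite el in ON' sd'.
(* [D] indexes [M] without [A], together with [m]: there the zeros agree, and at the other indices
   of [M] the weights agree. *)
pose D j := index_set M j && (`[< ~ A (int_of_index j) >] || (int_of_index j == m)).
have DM j : D j -> index_set M j by case/andP.
have eq_v j : D j -> index_seq M nu j = index_seq M nu' j.
  move=> /andP[Mj]; rewrite !index_seqE // => /orP[/asboolP nA|/eqP -> //].
  by apply: eq_nu; split=> //; apply/index_setP.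
have eq_w j : index_set M j -> A (int_of_index j) -> index_seq M gam j = index_seq M gam' j.
  by move=> Mj Aj; rewrite !index_seqE // eq_gam.
have eq_w' j : index_set M j -> ~~ D j -> index_seq M gam j = index_seq M gam' j.
  move=> Mj; rewrite /D Mj negb_or => /andP[/asboolP nnA _].
  by apply: eq_w => //; apply: contrapT.
have Mm : index_set M (index_of_int m) by apply/index_setP; rewrite index_of_intK; apply: subAM.
have Dm : D (index_of_int m) by rewrite /D Mm index_of_intK eqxx orbT.
have gm : index_seq M gam (index_of_int m) = index_seq M gam' (index_of_int m).
  by apply: eq_w; rewrite ?index_of_intK.
have [cc /funext gg] := spectral_data_unique sd sd' escape DM eq_v eq_w' Dm gm.
rewrite -gg in ON' sd'.
have [aa /funext bb] := orthonormal_unique b_gt0 b'_gt0 ON ON'.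
(* By [cc] the differences [h1 - h2] and [h1' - h2'] are equal, so the case [h2 = h2'] reduces to
   [h1 = h1']. *)
suff main : h1 = h1' -> [/\ forall n, a n = a' n, forall n, b n = b' n, h2 = h2' &
    limit_circle a b -> g = g'].
  split=> // hh2; have hh1 : h1 = h1' by move: cc; rewrite hh2 => /addIr.
  by have [? ? _ ?] := main hh1; split.
move=> hh1.
have aaE : a = a'.
  by apply/funext => n; have := aa n; rewrite /shifted_diagonal hh1 => /addIr.
have hh2 : h2 = h2' by move: cc; rewrite hh1 => /addrI/oppr_inj.
split=> [n|n||lc]; rewrite ?aaE ?bb //.
have [f [[k Jf] tf f01 fE]] := setup_zero_solution ts.
have [f' [[k' Jf'] _ _ fE']] := setup_zero_solution ts'.
rewrite -aaE -bb -hh1 el -gg in Jf' fE'.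
(* Both functions are computed from the same poles, weights and polynomials, so one nonzero function
   lies in the domains for [g] and for [g']. *)
suff ff : f' = f by rewrite ff in Jf'; apply: (boundary_condition_unique b_gt0 lc Jf Jf' tf f01).
case: fE fE' => [[j Mj [l0 ->]]|[n0 fE]] [[j' Mj' [l0' ->]]|[n0' fE']].
- suff -> : j = j' by [].
  by apply/eqP; apply: contraT => /(index_inj ts Mj Mj'); rewrite l0 l0' eqxx.
- by have := n0' _ Mj; rewrite l0 eqxx.
- by have := n0 _ Mj'; rewrite l0' eqxx.
apply/funext => n; have [I1 S1] := fE n; have [I2 S2] := fE' n.
by apply: complex_eqP; [apply: sums_unique S2 S1 | rewrite I1 I2].
Qed.
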